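(* If $C\subseteq C_{\hat p}$ is a cut which is a sub-semiring of ${}^*\mathbb N$ (closed under addition and multiplication, containing $0$ and $1$) and which is not a $\sigma$-set, then $\mathbb R^C:=f_{\overline{\mathbb Q}}^{-1}[C]$, ordered by $\le$, is an $\aleph_1$-saturated real-closed field. In particular $\mathbb R^\delta:=f_{\overline{\mathbb Q}}^{-1}[C_{\hat p}]$ is an $\aleph_1$-saturated real-closed field.
   Context: Let $\mathcal F$ be a countably incomplete ultrafilter on a set $I$, ${}^*\mathbb N=\mathbb N^I/\mathcal F$ (with $\mathbb N\subseteq{}^*\mathbb N$), and call a set internal if it lies in ${}^*A$ for some $A$ in the superstructure $V(\mathbb N)$, where $*$ is the elementary embedding induced by the ultrapower. A $\sigma$-set is a union of countably many internal subsets of ${}^*\mathbb N$. Let $\hat p\in{}^*\mathbb N\setminus\mathbb N$ be a nonstandard prime and $\mathbb F_{\hat p}=\{\hat n:\hat n<\hat p\}$ with operations modulo $\hat p$. Standing assumptions: $\mathbb F_{\hat p}$ contains a subfield isomorphic to the field $\overline{\mathbb Q}\cap\mathbb R$ of real algebraic numbers, and contains no square root of $-1$. For $a\in\mathbb F_{\hat p}$ let $|a|=\min(a,\hat p-a)$. The internal function $f_{\overline{\mathbb Q}}:\mathbb F_{\hat p}\to{}^*\mathbb N$ sends $x$ to the minimum of $n+\lceil\log_2\max(m,k)\rceil$ over all $n,m,k\in{}^*\mathbb N$ with $n\ge1$, $k\ne0$ in $\mathbb F_{\hat p}$, such that $kx$ is an eigenvalue of some internal $n\times n$ matrix over $\mathbb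 F_{\hat p}$ with all entries of absolute value at most $m$. $[\hat n]=\{\hat m:\hat m<\hat n\}$. $\phi_2(\hat n)$: for all $x,y\in f_{\overline{\mathbb Q}}^{-1}[[\hat n]]$ there is $z\in\mathbb F_{\hat p}$ with $x^2+y^2=z^2$; for odd standard $d>1$, $\phi_d(\hat n)$: for all $a_0,\dots,a_{d-1}\in f_{\overline{\mathbb Q}}^{-1}[[\hat n]]$ there is $x\in\mathbb F_{\hat p}$ with $x^d+\sum_{i<d}a_ix^i=0$. For $d\in\{2,3,5,7,\dots\}$, $\hat n_d$ is the maximum of the internal, downward-closed set of $\hat n$ satisfying $\phi_d$ (it contains $\mathbb N$ and omits $\hat p$). $C_{\hat p}=\bigcap_{d\in\{2,3,5,7,\dots\},\,i\ge1}[\lceil\hat n_d^{1/i}\rceil]$. A cut is a downward-closed subset of ${}^*\mathbb N$. For $a,b\in\mathbb F_{\hat p}$, $a\le b$ iff $b-a$ is a square in $\mathbb F_{\hat p}$. Saturation refers to the language of ordered fields. *)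

(* Defs.v *)
From HB Require Import structures.
From mathcomp Require Import all_boot all_order all_algebra generic_quotient.
From mathcomp Require Import boolp classical_sets functions cardinality filter.
From mathcomp Require Import realalg ordered_qelim.

Set Implicit Arguments.
Unset Strict Implicit.
Unset Printing Implicit Defensive.

Import Order.TTheory GRing.Theory.

Local Open Scope classical_set_scope.
Local Open Scope quotient_scope.

Definition countably_incomplete (I : Type) (F : set_system I) : Prop :=
  exists A : nat -> set I, (forall n, F (A n)) /\ ~ F (\bigcap_n A n).

Section UltraEquivalence.
Context (I : Type) (F : set_system I) (FU : UltraFilter F).

Definition ultra_eq (u v : I -> nat) : bool := `[< F [set i | u i = v i] >].

Lemma ultra_eq_refl : reflexive ultra_eq.
Proof. by move=> u; apply/asboolP; apply: filterE. Qed.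

Lemma ultra_eq_sym : symmetric ultra_eq.
Proof.
by move=> u v; apply/asboolP/asboolP; apply: filterS => i /= ->.
Qed.

Lemma ultra_eq_trans : transitive ultra_eq.
Proof.
move=> v u w /asboolP uv /asboolP vw; apply/asboolP.
by apply: filterS2 uv vw => i /= -> ->.
Qed.

Canonical ultra_equiv := EquivRel ultra_eq ultra_eq_refl ultra_eq_sym
  ultra_eq_trans.

(* The ultrapower nat^I / F. *)
Definition hypernat := {eq_quot ultra_equiv}.

HB.instance Definition _ := Choice.on hypernat.
HB.instance Definition _ := EqQuotient.on hypernat.

Definition hconst (n : nat) : hypernat := \pi_hypernat (fun=> n).

Definition hlift1 (f : nat -> nat) (x : hypernat) : hypernat :=
  \pi_hypernat (fun i => f (repr x i)).

Definition hlift2 (f : nat -> nat -> nat) (x y : hypernat) : hypernat :=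
  \pi_hypernat (fun i => f (repr x i) (repr y i)).

Lemma pi_ultra_eq (u v : I -> nat) :
  \pi_hypernat u = \pi_hypernat v <-> F [set i | u i = v i].
Proof. by split=> [/eqmodP/asboolP|uv] //; apply/eqmodP/asboolP. Qed.

Lemma repr_ultra (u : I -> nat) :
  F [set i | repr (\pi_hypernat u) i = u i].
Proof. by apply/pi_ultra_eq; rewrite reprK. Qed.

Lemma hlift1_pi f u : hlift1 f (\pi_hypernat u) = \pi_hypernat (fun i => f (u i)).
Proof. by apply/pi_ultra_eq; apply: filterS (repr_ultra u) => i /= ->. Qed.

Lemma hlift2_pi f u v : hlift2 f (\pi_hypernat u) (\pi_hypernat v) = \pi_hypernat (fun i => f (u i) (v i)).
Proof.
apply/pi_ultra_eq.
by apply: filterS2 (repr_ultra u) (repr_ultra v) => i /= -> ->.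
Qed.

Lemma hlift2A f : associative f -> associative (hlift2 f).
Proof.
move=> fA; elim/quotW=> u; elim/quotW=> v; elim/quotW=> w.
rewrite (hlift2_pi f v w) (hlift2_pi f u v) !hlift2_pi.
by congr (\pi_hypernat _); apply/funext => i; rewrite fA.
Qed.

Lemma hlift2C f : commutative f -> commutative (hlift2 f).
Proof.
move=> fC; elim/quotW=> u; elim/quotW=> v.
by rewrite !hlift2_pi; congr (\pi_hypernat _); apply/funext => i; rewrite fC.
Qed.

Lemma hlift2_idl n f : left_id n f -> left_id (hconst n) (hlift2 f).
Proof.
move=> fn; elim/quotW=> u.
by rewrite hlift2_pi; congr (\pi_hypernat _); apply/funext => i; rewrite fn.
Qed.

Lemma hlift2Dl f g : left_distributive f g ->
  left_distributive (hlift2 f) (hlift2 g).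
Proof.
move=> fg; elim/quotW=> u; elim/quotW=> v; elim/quotW=> w.
rewrite (hlift2_pi g u v) (hlift2_pi f u w) (hlift2_pi f v w) !hlift2_pi.
by congr (\pi_hypernat _); apply/funext => i; rewrite fg.
Qed.

Lemma hlift2_0l f : left_zero 0%N f -> left_zero (hconst 0) (hlift2 f).
Proof.
move=> f0; elim/quotW=> u.
by rewrite hlift2_pi; congr (\pi_hypernat _); apply/funext => i; rewrite f0.
Qed.

Lemma hconst1_neq0 : hconst 1 != hconst 0.
Proof.
apply/eqP => /pi_ultra_eq F0; apply: (@filter_not_empty _ F _).
by apply: filterS F0.
Qed.

HB.instance Definition _ := GRing.isNmodule.Build hypernat
  (hlift2A addnA) (hlift2C addnC) (hlift2_idl add0n).

HB.instance Definition _ := GRing.Nmodule_isComNzSemiRing.Build hypernat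
  (hlift2A mulnA) (hlift2C mulnC) (hlift2_idl mul1n) (hlift2Dl mulnDl)
  (hlift2_0l mul0n) hconst1_neq0.

Definition hle (x y : hypernat) : bool :=
  `[< F [set i | (repr x i <= repr y i)%N] >].

Lemma hle_pi u v : hle (\pi_hypernat u) (\pi_hypernat v) <-> F [set i | (u i <= v i)%N].
Proof.
split=> [/asboolP uv|uv]; [|apply/asboolP]; move: (repr_ultra u) => ru;
  by apply: filterS3 ru (repr_ultra v) uv => i /= -> ->.
Qed.

Lemma hle_refl : reflexive hle.
Proof. by move=> x; apply/asboolP; apply: filterE => i /=. Qed.

Lemma hle_anti : antisymmetric hle.
Proof.
move=> x y /andP[/asboolP xy /asboolP yx]; rewrite -[x]reprK -[y]reprK.
apply/pi_ultra_eq; apply: filterS2 xy yx => i /= xy yx.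
by apply/eqP; rewrite eqn_leq xy.
Qed.

Lemma hle_trans : transitive hle.
Proof.
move=> y x z /asboolP xy /asboolP yz; apply/asboolP.
by apply: filterS2 xy yz => i /=; apply: leq_trans.
Qed.

Lemma hle_total : total hle.
Proof.
move=> x y; have [xy|xy] := in_ultra_setVsetC [set i | (repr x i <= repr y i)%N] FU.
  by apply/orP; left; apply/asboolP.
apply/orP; right; apply/asboolP; apply: filterS xy => i /= /negP.
by rewrite -ltnNge => /ltnW.
Qed.

Fact hypernat_display : Order.disp_t. Proof. exact: Order.Disp tt tt. Qed.

HB.instance Definition _ := Order.Le_isPOrder.Build hypernat_display hypernat
  hle_refl hle_anti hle_trans.

HB.instance Definition _ := Order.POrder_isTotal.Build hypernat_display hypernat
  hle_total.

(* In the bounded ultrapower of V(N), the elements of *P(N) are the classes of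
   families (A i) of subsets of N, identified with the sets of those x that
   belong to them F-almost everywhere. *)
Definition internal (S : set hypernat) : Prop :=
  exists A : I -> set nat, S = [set x | F [set i | A i (repr x i)]].

Definition sigma_set (S : set hypernat) : Prop :=
  exists A : nat -> set hypernat,
    (forall k, internal (A k)) /\ S = \bigcup_k A k.

Definition nonstandard (x : hypernat) : Prop := forall n, x <> hconst n.

Definition hprime (x : hypernat) : Prop := F [set i | prime (repr x i)].

Definition hmod : hypernat -> hypernat -> hypernat := hlift2 modn.
Definition hsub : hypernat -> hypernat -> hypernat := hlift2 subn.
(* up_log 2 n is the ceiling of the binary logarithm of n > 0. *)
Definition hceil_log2 : hypernat -> hypernat := hlift1 (up_log 2).

End UltraEquivalence.

Section HyperfiniteField.
Local Open Scope ring_scope.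
Local Open Scope order_scope.
Context (I : Type) (F : set_system I) (FU : UltraFilter F).
Local Notation "'*N'" := (hypernat FU) (at level 0).

Definition is_least (S : set *N) (x : *N) : Prop :=
  S x /\ forall y, S y -> x <= y.
Definition is_greatest (S : set *N) (x : *N) : Prop :=
  S x /\ forall y, S y -> y <= x.

(* These return 0 when there is no least, resp. greatest, element. *)
Definition hmin (S : set *N) : *N := xget 0%R (is_least S).
Definition hmax (S : set *N) : *N := xget 0%R (is_greatest S).

Definition cut (C : set *N) : Prop := forall x y, x <= y -> C y -> C x.

Definition sub_semiring (C : set *N) : Prop :=
  [/\ C 0%R, C 1%R, forall x y, C x -> C y -> C (x + y)%R
    & forall x y, C x -> C y -> C (x * y)%R].

Variable p : *N.

Definition hF : set *N := [set x | x < p].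

Definition addp (x y : *N) : *N := hmod (x + y)%R p.
Definition mulp (x y : *N) : *N := hmod (x * y)%R p.
Definition subp (x y : *N) : *N := hmod (x + hsub p y)%R p.
Definition expp (x : *N) (n : nat) : *N := iter n (mulp x) 1%R.

Definition lep (a b : *N) : Prop := exists2 z, hF z & mulp z z = subp b a.

Definition contains_real_algebraic_numbers : Prop :=
  exists g : realalg -> *N,
    [/\ forall x, hF (g x), g 0%R = 0%R, g 1%R = 1%R,
        forall x y, g (x + y)%R = addp (g x) (g y)
      & forall x y, g (x * y)%R = mulp (g x) (g y)].

Definition no_sqrt_of_minus_one : Prop :=
  ~ exists2 z, hF z & mulp z z = subp 0%R 1%R.

(* An internal n x n matrix over the hyperfinite field is represented by a
   family of matrices over the prime fields 'F_(p i), with p i prime F-almost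
   everywhere; by repr_ultra, replacing the representatives of p and n changes
   the index type only on an F-negligible set. *)
Definition internal_matrix (n : *N) : Type :=
  forall i : I, 'M['F_(repr p i)]_(repr n i).

Definition Fabs (q : nat) (a : 'F_q) : nat := minn a (q - a).

Definition entries_bounded_by (n m : *N) (M : internal_matrix n) : Prop :=
  F [set i | forall r s, (Fabs (M i r s) <= repr m i)%N].

Definition internal_eigenvalue (n : *N) (M : internal_matrix n) (a : *N) :
    Prop :=
  F [set i | eigenvalue (M i) (repr a i)%:R%R].

Definition fQbar (x : *N) : *N :=
  hmin [set h | exists n m k : *N,
    [/\ (1%R : *N) <= n, hmod k p <> 0%R,
        h = (n + hceil_log2 (Order.max m k))%R
      & exists2 M : internal_matrix n,
          entries_bounded_by m M & internal_eigenvalue M (mulp k x)]].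

Definition fQbar_preimage (C : set *N) : set *N :=
  [set x | hF x /\ C (fQbar x)].

Definition initial_segment (n : *N) : set *N := [set m | m < n].

Definition phi (d : nat) (n : *N) : Prop :=
  if d == 2%N then
    forall x y, fQbar_preimage (initial_segment n) x ->
      fQbar_preimage (initial_segment n) y ->
      exists2 z, hF z & addp (mulp x x) (mulp y y) = mulp z z
  else
    forall a : 'I_d -> *N,
      (forall i, fQbar_preimage (initial_segment n) (a i)) ->
      exists2 x, hF x &
        addp (expp x d) (\big[addp/0%R]_(i < d) mulp (a i) (expp x i)) = 0%R.

Definition degree_index (d : nat) : Prop :=
  d = 2%N \/ odd d /\ (1 < d)%N.

Definition n_ (d : nat) : *N := hmax (phi d).

(* The least r with n <= r ^ i is the ceiling of the i-th root of n. *)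
Definition hceil_root (i : nat) (n : *N) : *N :=
  hmin [set r | n <= (r ^+ i)%R].

Definition C_ : set *N :=
  \bigcap_(di in [set di : nat * nat | degree_index di.1 /\ (1 <= di.2)%N])
    initial_segment (hceil_root di.2 (n_ di.1)).

End HyperfiniteField.

Section Saturation.
Local Open Scope ring_scope.
Variable R : realDomainType.

Fixpoint term_params (t : GRing.term R) : set R :=
  match t with
  | GRing.Var _ | GRing.NatConst _ => set0
  | GRing.Const c => [set c]
  | GRing.Opp t1 | GRing.NatMul t1 _ | GRing.Inv t1 | GRing.Exp t1 _ =>
      term_params t1
  | GRing.Add t1 t2 | GRing.Mul t1 t2 => term_params t1 `|` term_params t2
  end.

Fixpoint formula_params (phi : ord.formula R) : set R :=
  match phi with
  | ord.Bool _ => set0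
  | ord.Unit t => term_params t
  | ord.Equal t1 t2 | ord.Lt t1 t2 | ord.Le t1 t2 =>
      term_params t1 `|` term_params t2
  | ord.And f1 f2 | ord.Or f1 f2 | ord.Implies f1 f2 =>
      formula_params f1 `|` formula_params f2
  | ord.Not f1 | ord.Exists _ f1 | ord.Forall _ f1 => formula_params f1
  end.

(* The variable of the type is 'X_0; in the environment [:: x] any other free
   variable has the value 0, so it stands for the constant 0. *)
Definition aleph1_saturated : Prop :=
  forall (A : set R) (Phi : set (ord.formula R)),
    countable A ->
    (forall phi, Phi phi -> formula_params phi `<=` A) ->
    (forall S : set (ord.formula R), finite_set S -> S `<=` Phi ->
       exists x, forall phi, S phi -> ord.holds [:: x] phi) ->
    exists x, forall phi, Phi phi -> ord.holds [:: x] phi.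

End Saturation.

Section Conclusion.
Local Open Scope ring_scope.
Context (I : Type) (F : set_system I) (FU : UltraFilter F).

(* h is an isomorphism of ordered fields from R onto the subset S of the
   hyperfinite field, with its operations modulo p and the relation lep p. *)
Definition ordered_field_iso (p : hypernat FU) (S : set (hypernat FU))
    (R : rcfType) (h : R -> hypernat FU) : Prop :=
  [/\ injective h /\ range h = S, h 0 = 0 /\ h 1 = 1,
      forall x y, h (x + y) = addp p (h x) (h y),
      forall x y, h (x * y) = mulp p (h x) (h y)
    & forall x y, x <= y <-> lep p (h x) (h y)].

Definition aleph1_saturated_rcf (p : hypernat FU) (S : set (hypernat FU)) :
    Prop :=
  exists (R : rcfType) (h : R -> hypernat FU),
    ordered_field_iso p S h /\ aleph1_saturated R.

End Conclusion.

(* Main.v *)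
(* The hyperfinite field is the ultraproduct of the prime fields 'F_(p i), and
   the height of x is small exactly when x is a root of a small internal
   polynomial with integer coefficients.  Tensor products and block companion
   matrices show that the height of a sum, product, inverse or root of a monic
   polynomial of standard degree is bounded by a fixed polynomial in the given
   heights, so a cut closed under + and * yields a subfield R^C that is
   relatively algebraically closed (for standard degrees).  Below the
   thresholds n_d, the squares are closed under addition and odd polynomials
   have roots, so Artin-Schreier applies: R^C is real closed for the order
   given by the squares of the hyperfinite field.
     By quantifier elimination, saturation of a real closed field reduces to
   filling countable order gaps.  Since C is not a sigma-set, the countably many
   rational interpolants of a countable gap have heights bounded by one c in C;
   the internal set of elements of height below c then contains a point of the
   gap, by saturation of internal sets.
     For C_p: an element of finite height is a root of one standard polynomial,
   hence lies in the copy of the real algebraic numbers, so all n_d are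
   nonstandard; and C_p is an intersection of countably many internal sets, so
   saturation prevents it from being a sigma-set. *)
Require Import Defs.
From HB Require Import structures.
From mathcomp Require Import all_boot all_order all_algebra.
From mathcomp Require Import all_fingroup all_solvable all_field.
From mathcomp Require Import boolp classical_sets cardinality filter.
From mathcomp Require Import polyrcf realalg ordered_qelim qe_rcf generic_quotient.
From mathcomp Require Import ring lra zify.

Set Implicit Arguments.
Unset Strict Implicit.
Unset Printing Implicit Defensive.

Import Order.TTheory GRing.Theory Num.Theory.

(** The height mixes two quantities of different nature, the dimension of a matrix and the logarithm
    of its entries. Tensoring multiplies dimensions but only adds logarithms, up to small terms;
    this is why closure of the cut under sums and products is enough and no exponential is ever
    applied to a height. To add or multiply two eigenvalues, both must first belong to one common
    eigenvector, so [int_acts] keeps the vector and the denominator explicit. Inverses escape this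
    method, since inverting a matrix leaves the integers; they go through a bounded integer
    polynomial read backwards. The same polynomial serves again at standard height: only finitely
    many candidates remain, and the ultrafilter selects one. The thresholds give roots in the
    hyperfinite field only; that these roots lie in R^C is a separate fact about heights. The order
    is total because it is so at almost every coordinate: in a finite field without a square root of
    -1, every element or its opposite is a square. Transfer is done by hand: [cost_attained],
    [cheap] and [phi_at] are the coordinatewise forms of the internal notions, each with its own
    transfer lemma. *)

(** * Splitting fields of polynomials over an arbitrary field *)

Section SplittingField.
Local Open Scope ring_scope.

Lemma irreducible_factor (F : fieldType) (p : {poly F}) :
  (1 < size p)%N -> exists2 r : {poly F}, r %| p & irreducible_poly r.
Proof.
move=> p1.
have exn : exists n, `[< exists2 r : {poly F}, r %| p & (1 < size r)%N && (size r == n) >].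
  by exists (size p); apply/asboolP; exists p; rewrite // p1 eqxx.
have [n /asboolP[r rp /andP[r1 /eqP <-]] nmin] := ex_minnP exn.
exists r => //; split=> // q q1 qr.
have r0 : r != 0 by rewrite -size_poly_gt0 ltnW.
have q0 : q != 0 := dvdpN0 qr r0.
rewrite -dvdp_size_eqp // eqn_leq dvdp_leq //= nmin //; apply/asboolP.
exists q; first exact: dvdp_trans qr rp.
by rewrite eqxx andbT ltn_neqAle eq_sym q1 size_poly_gt0.
Qed.

(** Induction on the size with the base field varying: a root of an irreducible factor is adjoined
    and the cofactor is split over the larger field K; [baseFieldType] then reads the tower over
    F. *)
Lemma split_extension (F : fieldType) (p : {poly F}) : p != 0 ->
  exists (L : fieldExtType F) (zs : seq L),
    map_poly (in_alg L) p %= \prod_(z <- zs) ('X - z%:P).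
Proof.
move: {2}_.+1 (ltnSn (size p)) => n; elim: n => // n IHn in F p * => pn p0.
have [p1|p1] := leqP (size p) 1.
  exists F^o, [::].
  by rewrite big_nil -size_poly_eq1 size_map_poly eqn_leq p1 size_poly_gt0.
have [r rp irr_r] := irreducible_factor p1.
have [K _ [x rx0 _]] := irredp_FAdjoin irr_r.
have /factor_theorem[q pq] : root (map_poly (in_alg K) p) x.
  by rewrite -(divpK rp) rmorphM rootM rx0 orbT.
have sz : size p = size (q * ('X - x%:P)) by rewrite -pq size_map_poly.
have q0 : q != 0.
  by move: p0; rewrite -size_poly_eq0 sz size_poly_eq0 mulf_eq0 => /norP[].
have [|L [zs qzs]] := IHn K q _ q0.
  by move: pn; rewrite sz size_mul ?polyXsubC_eq0 // size_XsubC addn2.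
exists (baseFieldType L), ((in_alg L x : baseFieldType L) :: zs).
have -> : map_poly (in_alg (baseFieldType L)) p =
    map_poly (in_alg L) (map_poly (in_alg K) p).
  rewrite -map_poly_comp; apply: eq_map_poly => a.
  exact: baseField_scaleE a 1.
rewrite big_cons pq rmorphM /= map_polyXsubC mulrC.
exact: eqp_mull.
Qed.

(** Galois theory needs a normal extension, so the field of [split_extension] is cut down to the
    subfield generated by the roots. *)
Lemma splitting_field (F : fieldType) (p : {poly F}) : p != 0 ->
  exists L : splittingFieldType F,
    splittingFieldFor 1 (map_poly (in_alg L) p) {:L}.
Proof.
move=> /split_extension[L [ys Dp]].
pose K : fieldExtType F := subvs_of <<1 & ys>>.
pose toL := linfun (vsval : K -> L).
have [zs Dys] : exists zs, map toL zs = ys.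
  exists (map (vsproj _) ys); rewrite -map_comp map_id_in // => y ys_y.
  by rewrite /= lfunE /= vsprojK ?seqv_sub_adjoin.
have splitK : splittingFieldFor 1 (map_poly (in_alg K) p) {:K}.
  exists zs.
    rewrite -(eqp_map toL) rmorph_prod -map_poly_comp.
    rewrite (eq_map_poly (g := in_alg L)); last by move=> a; apply: rmorph_alg.
    rewrite -Dys big_map in Dp; apply: eqp_trans Dp _.
    rewrite (eq_bigr (fun z => map_poly toL ('X - z%:P))) ?eqpxx // => z _.
    by rewrite map_polyXsubC.
  apply/vspaceP=> u; rewrite memvf.
  have : val u \in (toL @: <<1 & zs>>)%VS.
    by rewrite aimg_adjoin_seq aimg1 Dys (valP u).
  by case/memv_imgP=> v zs_v; rewrite lfunE => /val_inj->.
have ax : SplittingField.axiom K.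
  exists (map_poly (in_alg K) p) => //.
  by apply/polyOver1P; exists p.
pose M := FieldExt_isSplittingField.Build F K ax.
pose K' : splittingFieldType F := HB.pack K M.
by exists K'.
Qed.

End SplittingField.

(** * Artin's Galois-theoretic proof: square roots and roots in odd degree give real closedness *)

Section FundamentalTheoremOfAlgebra.
Local Open Scope ring_scope.
Variable R : realFieldType.
Hypothesis sqrtR : forall x : R, 0 <= x -> exists y, y ^+ 2 = x.
Hypothesis oddR : forall P : {poly R}, P != 0 -> ~~ odd (size P) ->
  exists x, root P x.

Section Splitting.
Variable L : splittingFieldType R.
Variable im : L.
Hypothesis im2 : im ^+ 2 = -1.

Let galL (K : {subfield L}) : galois K {:L}.
Proof.
rewrite /galois subvf normalFieldf andbT; apply/separableP => x _.
by apply: pcharf0_separable => n; rewrite pchar_lalg pchar_num.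
Qed.

(** The minimal polynomial has odd degree, that is even size, so [oddR] gives it a root in R; being
    irreducible, it is linear. *)
Lemma odd_degree_in1 (x : L) : odd (adjoin_degree 1 x) -> x \in 1%VS.
Proof.
move=> oddx; have /polyOver1P[p Dp] := minPolyOver 1 x.
have szp : size p = (adjoin_degree 1 x).+1.
  by rewrite -(size_map_poly (in_alg L)) -Dp size_minPoly.
have p0 : p != 0 by rewrite -size_poly_eq0 szp.
have [|y py] := oddR p0; first by rewrite szp /= negbK.
have /minPoly_irr : 'X - y%:A%:P \is a polyOver (1%VS : {vspace L}).
  by rewrite polyOverXsubC rpredZ ?mem1v.
move=> /(_ x); rewrite Dp dvdp_XsubCl rootE horner_map (rootP py) rmorph0 eqxx.
rewrite -size_poly_eq1 size_XsubC orbF => /(_ isT) /eqp_size.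
by rewrite size_XsubC -Dp size_minPoly -adjoin_deg_eq1 => /eqP; rewrite eqSS eq_sym.
Qed.

(** The fixed field of a Sylow 2-subgroup has odd degree over R, hence equals R, and the subgroup is
    the whole group. *)
Lemma galois_pgroup2 : (2.-group 'Gal({:L} / 1))%g.
Proof.
have [P sylP] := Sylow_exists 2 'Gal({:L} / 1%AS)%G.
have [sPG evenP oddPG] := and3P sylP.
have dimP := dim_fixed_galois (galL 1) sPG.
suff /eqP fixP1 : fixedField P == 1%VS.
  rewrite (_ : 'Gal({:L} / 1)%g = P) // -[in RHS](gal_fixedField P).
  by rewrite fixP1.
rewrite eqEsubv sub1v andbT; apply/subvP => x xP.
apply: odd_degree_in1; rewrite adjoin_degreeE dimv1 divn1.
apply: (@dvdn_odd _ (\dim (fixedField P))).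
  apply: field_dimS; apply/FadjoinP; split=> //; exact: sub1v.
by move: dimP; rewrite dimv1 divn1 => ->; rewrite odd_2'nat.
Qed.

Let C : {subfield L} := <<1; im>>%AS.

Lemma mem_adjoin_im x : reflect (exists u v : R, x = u%:A + v%:A * im) (x \in C).
Proof.
apply: (iffP idP) => [|[u [v ->]]]; last first.
  rewrite rpredD ?rpredM ?memv_adjoin //; apply: (subvP (subv_adjoin _ _));
    by rewrite rpredZ ?mem1v.
move=> /Fadjoin_polyP[p /polyOver1P[q ->] ->].
elim/poly_ind: q => [|q c [u [v IHq]]].
  by exists 0, 0; rewrite rmorph0 horner0 !scale0r mul0r addr0.
exists (c - v), u.
rewrite rmorphD rmorphM /= map_polyX map_polyC hornerMXaddC IHq mulrDl -mulrA -expr2 im2.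
by rewrite /= scalerBl mulrN1 addrC addrAC -addrA.
Qed.

Lemma sqrt_adjoin_im x : x \in C -> exists2 w, w \in C & w ^+ 2 = x.
Proof.
move=> /mem_adjoin_im[a [b ->]].
(* [r] is the modulus of a + b i. The parts of the root have squares (r + a) / 2 and (r - a) / 2,
   both nonnegative once r >= 0, and the sign of [v] is fixed by 2uv = b. *)
have [r r2] : exists r, r ^+ 2 = a ^+ 2 + b ^+ 2 by apply: sqrtR; nra.
wlog r0 : r r2 / 0 <= r.
  move=> wl; have [/wl|/ltW r0] := lerP 0 r; first exact.
  by apply: (wl (- r)); rewrite ?sqrrN ?oppr_ge0.
have [u u2] : exists u, u ^+ 2 = (r + a) / 2 by apply: sqrtR; nra.
have [v v2] : exists v, v ^+ 2 = (r - a) / 2 by apply: sqrtR; nra.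
have uv2 : (2 * u * v) ^+ 2 = b ^+ 2.
  have -> : (2 * u * v) ^+ 2 = 4 * (u ^+ 2 * v ^+ 2) by ring.
  by rewrite u2 v2; have -> : b ^+ 2 = r ^+ 2 - a ^+ 2 by [rewrite r2; ring]; field.
wlog uvb : v v2 uv2 / 2 * u * v = b.
  move=> wl; have /orP[/eqP|/eqP uvb] : (2 * u * v == b) || (2 * u * v == - b).
    by rewrite -eqf_sqr uv2.
    exact: wl.
  by apply: (wl (- v)); rewrite ?sqrrN ?mulrN ?uvb ?opprK // sqrrN.
have uva : u ^+ 2 - v ^+ 2 = a by rewrite u2 v2; field.
exists (u%:A + v%:A * im); first by apply/mem_adjoin_im; exists u, v.
rewrite -uva -uvb scalerBl.

have -> : (u%:A + v%:A * im) ^+ 2 =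
   u%:A ^+ 2 + v%:A ^+ 2 * im ^+ 2 + 2 * u%:A * v%:A * im by ring.
have AM (c d : R) : (c * d)%:A = c%:A * d%:A :> L by rewrite -[LHS]in_algE rmorphM.
rewrite im2 [(u ^+ 2)%:A]AM [(v ^+ 2)%:A]AM !AM scaler_nat.
ring.
Qed.

(** A nontrivial 2-group has a subgroup of index 2, whose fixed field would be a quadratic extension
    of R(im); there is none, since R(im) contains the square roots of all its elements. *)
Lemma adjoin_im_full : C = fullv :> {vspace L}.
Proof.
have evenH : (2.-group 'Gal({:L} / C))%g.
  exact: pgroupS (galS _ (sub1v _)) galois_pgroup2.
have [H1|H1] := leqP #|'Gal({:L} / C)%g| 1.
  apply/eqP; rewrite eqEdim subvf /=.
  rewrite -(divnK (field_dimS (subvf C))) (galois_dim (galL C)).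
  by rewrite -[X in (_ <= X)%N]mul1n leq_mul2r H1 orbT.
have [P sPH iPH] : exists2 P : {group gal_of {:L}},
    P \subset 'Gal({:L} / C)%g & #|'Gal({:L} / C) : P|%g = 2%N.
  have [P [sPH _ oP]] := normal_pgroup evenH (normal_refl _) (leq_pred _).
  have [|_ _ [n oH]] := pgroup_pdiv evenH; first by rewrite -cardG_gt1.
  exists P => //; rewrite -divgS // oP oH pfactorK //= -expnB ?subSnn //.
have dimP := dim_fixed_galois (galL C) sPH; rewrite iPH in dimP.
have sCP : (C <= fixedField P)%VS by rewrite -galois_connection ?subvf.
have dimP2 : \dim (fixedField P) = (2 * \dim C)%N.
  by rewrite -dimP divnK // field_dimS.
have [x xP xC] : exists2 x, x \in fixedField P & x \notin C.
  apply: contrapT => noX; have /dimvS : (fixedField P <= C)%VS.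
    by apply/subvP => x xP; apply: contrapT => xC; apply: noX; exists x => //; apply/negP.
  by rewrite dimP2 leqNgt -[X in (X < _)%N]mul1n ltn_mul2r adim_gt0.
have degx : adjoin_degree C x = 2%N.
  have : (adjoin_degree C x %| 2)%N.
    rewrite adjoin_degreeE -dimP.
    rewrite -(@dvdn_pmul2r (\dim C)) ?adim_gt0 // !divnK ?field_dimS ?subv_adjoin //.
    by apply/FadjoinP.
  have : adjoin_degree C x != 1%N by rewrite adjoin_deg_eq1.
  move=> deg1 /dvdn_leq-/(_ isT); have := adim_gt0 <<C; x>>%AS.
  by move: deg1; rewrite /adjoin_degree; case: (_.-1) => [|[|n]].
have /polyOverP Cp := minPolyOver C x.
have szp : size (minPoly C x) = 3%N by rewrite size_minPoly degx.
set p := minPoly C x in Cp szp.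
have := root_minPoly C x; rewrite rootE -/p horner_coef szp.
rewrite !big_ord_recr big_ord0 /= add0r expr0 expr1 mulr1.
have -> : p`_2 = 1.
  by have /monicP := monic_minPoly C x; rewrite lead_coefE -/p szp.
rewrite mul1r => /eqP px.
have nz2 : 2 != 0 :> L by rewrite -(rmorph_nat (in_alg L)) fmorph_eq0 pnatr_eq0.
(* A quarter of the discriminant of the minimal polynomial; completing the square then expresses x
   inside C. *)
have : (p`_1 / 2) ^+ 2 - p`_0 \in C by rewrite rpredB ?rpredX ?rpred_div ?rpred_nat.
move=> /sqrt_adjoin_im[w wC w2].
case/negP: xC.
have : (x + p`_1 / 2) ^+ 2 == w ^+ 2.
  apply/eqP; rewrite w2.
  have -> : p`_0 = - (p`_1 * x + x ^+ 2).
    by apply/eqP; rewrite -addr_eq0 addrA px.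
  by field.
rewrite eqf_sqr => /orP[] /eqP xw.
  by rewrite -[x](addrK (p`_1 / 2)) xw rpredB ?rpred_div ?rpred_nat.
by rewrite -[x](addrK (p`_1 / 2)) xw rpredB ?rpredN ?rpred_div ?rpred_nat.
Qed.

End Splitting.

Theorem fundamental_algebra (P : {poly R}) : (1 < size P)%N ->
  exists u v, v = 0 /\ root P u \/ v != 0 /\ ('X - u%:P) ^+ 2 + (v ^+ 2)%:P %| P.
Proof.
move=> P1; have P0 : P != 0 by rewrite -size_poly_gt0 ltnW.
(* Splitting [P * M] instead of P ensures that the splitting field contains a square root of -1. *)
pose M : {poly R} := 'X^2 + 1%:P.
have szM : size M = 3%N by rewrite size_polyDl ?size_polyXn // size_polyC oner_eq0.
have M0 : M != 0 by rewrite -size_poly_eq0 szM.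
have [L [zs Dzs _]] := splitting_field (mulf_neq0 P0 M0).
have rootL (Q : {poly R}) : (1 < size Q)%N -> Q %| P * M ->
    exists z, root (map_poly (in_alg L) Q) z.
  move=> Q1; rewrite -(dvdp_map (in_alg L)) (eqp_dvdr _ Dzs) => /dvdp_prod_XsubC[m Qm].
  move: Q1; rewrite -(size_map_poly (in_alg L)) (eqp_size Qm).
  case: (mask m zs) Qm => [|z s] Qm; first by rewrite big_nil size_poly1.
  by exists z; rewrite (eqp_root Qm) root_prod_XsubC mem_head.
have [||im] := rootL M; rewrite ?szM ?dvdp_mull //.
rewrite rootE rmorphD /= map_polyXn map_polyC hornerD hornerXn hornerC /= scale1r.
rewrite addr_eq0 => /eqP im2.
have [||z Pz] := rootL P; rewrite ?dvdp_mulr //.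
have : z \in <<1; im>>%AS by rewrite adjoin_im_full // memvf.
move=> /(mem_adjoin_im im2)[u [v zuv]]; exists u, v.
have [v0|v0] := eqVneq v 0; [left|right].
  by move: Pz; rewrite zuv v0 scale0r mul0r addr0 -in_algE fmorph_root.
split=> //; set D := _ + _.
have szD : size D = 3%N.
  rewrite size_polyDl size_exp_XsubC // size_polyC; by case: eqP.
have D0 : D != 0 by rewrite -size_poly_eq0 szD.
have [c1 [c0 Qe]] : exists c1 c0 : R, P %% D = c1 *: 'X + c0%:P.
  have szQ : (size (P %% D)%R <= 2)%N by rewrite -ltnS -[3%N]szD ltn_modp.
  exists (P %% D)`_1, (P %% D)`_0; apply/polyP => k.
  rewrite coefD coefZ coefX coefC; case: k => [|[|k]] /=; rewrite ?mulr0 ?mulr1 ?add0r ?addr0 //.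
  by rewrite nth_default // (leq_trans szQ).
have Dz : root (map_poly (in_alg L) D) z.
  rewrite rootE zuv rmorphD rmorphXn /= map_polyXsubC map_polyC !hornerE /=.
  rewrite addrAC subrr add0r exprMn im2 -!in_algE rmorphXn /=.
  by rewrite mulrN1 addNr.
have : root (map_poly (in_alg L) (P %% D)) z.
  move: Pz; rewrite {1}(divp_eq P D) rmorphD rmorphM /= rootE hornerD hornerM.
  by rewrite (rootP Dz) mulr0 add0r.
rewrite Qe rootE rmorphD /= map_polyZ /= map_polyX map_polyC !hornerE.
rewrite zuv => /eqP Qz.
have Qim : c1%:A * v%:A * im = - (c0%:A + c1%:A * u%:A).
  by apply/eqP; rewrite -addr_eq0 -Qz; apply/eqP => /=; ring.
(* Squaring [Qim] turns the independence of 1 and [im] over R into a sum of two real squares equal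
   to 0. *)
have Q1 : c1 = 0.
  have : (c1 * v) ^+ 2 + (c0 + c1 * u) ^+ 2 = 0.
    apply: (fmorph_inj (in_alg L)); rewrite rmorph0 rmorphD !rmorphXn rmorphD !rmorphM.
    move: (congr1 (fun w => w ^+ 2) Qim); rewrite exprMn im2 sqrrN mulrN1 => <-.
    by rewrite subrr.
  move/eqP; rewrite paddr_eq0 ?sqr_ge0 // => /andP[].
  by rewrite sqrf_eq0 mulf_eq0 (negPf v0) orbF => /eqP.
move: Qz; rewrite Q1 !scale0r !mul0r add0r => /eqP.
rewrite scaler_eq0 oner_eq0 orbF => /eqP Q0.
by rewrite /dvdp Qe Q1 Q0 scale0r add0r polyC0.
Qed.

(** Factors are removed one at a time: a linear factor whose root lies outside [a, b] has constant
    sign there (negative if u > b, whence [- Q]), and a quadratic factor with v nonzero is positive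
    everywhere. *)
Theorem poly_ivt_of_sqrt_odd : Num.real_closed_axiom R.
Proof.
move=> P; move: {2}(size P) (leqnn (size P)) => n; elim: n P => [|n IHn] P.
  by rewrite leqn0 size_poly_eq0 => /eqP-> a b ab _; exists a; rewrite ?lexx ?ab ?root0.
move=> Pn a b ab Pab.
have [P1|P1] := leqP (size P) 1.
  exists a; rewrite ?lexx ?ab //; move: Pab; rewrite (size1_polyC P1) rootE !hornerC.
  by rewrite -eq_le eq_sym.
have ltP Q D : P = Q * D -> (1 < size D)%N -> (size Q <= n)%N.
  move=> PQ D1; rewrite -ltnS; apply: leq_trans Pn; rewrite PQ.
  have Q0 : Q != 0 by apply: contraTneq P1 => Q0; rewrite PQ Q0 mul0r size_poly0.
  have D0 : D != 0 by rewrite -size_poly_eq0; case: (size D) D1.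
  by rewrite size_mul //; case: (size D) D1 => [|[|k]] // _; rewrite !addnS ltnS leq_addr.
have [u [v [[v0 Pu]|[v0 /dvdpP[Q PQ]]]]] := fundamental_algebra P1.
  have [ua|ua] := lerP a u; [have [ub|ub] := lerP u b|].
  - by exists u; rewrite ?ua.
  - have /factor_theorem[Q PQ] := Pu.
    have [||x xab Qx] := IHn (- Q) _ a b ab.
    + by rewrite size_polyN; apply: ltP PQ _; rewrite size_XsubC.
    + move: Pab; rewrite PQ !hornerM !hornerXsubC !hornerN; nra.
    + by exists x => //; rewrite PQ rootM -rootN Qx.
  - have /factor_theorem[Q PQ] := Pu.
    have [||x xab Qx] := IHn Q _ a b ab.
    + by apply: ltP PQ _; rewrite size_XsubC.
    + move: Pab; rewrite PQ !hornerM !hornerXsubC; nra.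
    + by exists x => //; rewrite PQ rootM Qx.
have [||x xab Qx] := IHn Q _ a b ab.
- apply: ltP PQ _; rewrite size_polyDl size_exp_XsubC // size_polyC; by case: eqP.
- move: Pab; rewrite PQ !hornerM !hornerE.
  have : 0 < v ^+ 2 by rewrite exprn_even_gt0.
  move: (sqr_ge0 (a - u)) (sqr_ge0 (b - u)) => au bu vv.
  rewrite pmulr_lle0 ?pmulr_lge0 //; lra.
- by exists x => //; rewrite PQ rootM Qx.
Qed.
End FundamentalTheoremOfAlgebra.

(** * Real closed subfields of a field in which -1 is not a square *)

Section RealClosedAlgebra.
Local Open Scope ring_scope.

(* Every root in F of an irreducible factor (X - u)^2 + v^2 would give a square
   root of -1. *)
Lemma rcf_root_image (R : rcfType) (F : fieldType) (g : {rmorphism R -> F}) :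
    (forall z : F, z ^+ 2 != -1) ->
  forall (P : {poly R}) x, P != 0 -> root (map_poly g P) x -> exists r, g r = x.
Proof.
move=> nosq P; move: {2}(size P) (leqnn (size P)) => n.
elim: n P => [|n IHn] P.
  by rewrite leqn0 size_poly_eq0 => ->.
move=> Pn x P0 Px.
have P1 : (1 < size P)%N.
  rewrite -(size_map_poly g); apply: root_size_gt1 Px.
  by rewrite map_poly_eq0.
have [y y0|Q Q0|u [v]] := @fundamental_algebra R _ _ P P1.
- by exists (Num.sqrt y); rewrite sqr_sqrtr.
- by move=> /odd_poly_root[y Qy]; exists y.
have step Q D : P = Q * D -> (1 < size D)%N -> root (map_poly g Q) x ->
    exists r, g r = x.
  move=> PQ D1; apply: IHn; last first.
    by apply: contraNneq P0; rewrite PQ => ->; rewrite mul0r.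
  have Q0 : Q != 0 by apply: contraTneq P1 => Q0; rewrite PQ Q0 mul0r size_poly0.
  rewrite -ltnS; apply: leq_trans Pn; rewrite PQ.
  have D0 : D != 0 by rewrite -size_poly_eq0; case: (size D) D1.
  by rewrite size_mul //; case: (size D) D1 => [|[|k]] // _; rewrite !addnS ltnS leq_addr.
case=> [[_ /factor_theorem[Q PQ]]|[v0 /dvdpP[Q PQ]]].
  move: (Px); rewrite PQ rmorphM rootM /= => /orP[|].
    by apply: step PQ _; rewrite size_XsubC.
  by rewrite map_polyXsubC root_XsubC => /eqP->; exists u.
move: (Px); rewrite PQ rmorphM rootM /= => /orP[|].
  by apply: step PQ _; rewrite size_polyDl size_exp_XsubC // size_polyC; case: eqP.
rewrite rmorphD rmorphXn /= map_polyXsubC map_polyC rootE !hornerE /=.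
rewrite addr_eq0 rmorphXn => /eqP xu.
have gv0 : g v != 0 by rewrite fmorph_eq0.
have := nosq ((x - g u) / g v).
by rewrite expr_div_n xu mulNr divff ?eqxx // expf_neq0.
Qed.

Section OrderedSubfield.
Variables (F : fieldType) (S : divringClosed F).

Record subfield_of := Subfield_of { subfield_val : F; _ : subfield_val \in S }.
HB.instance Definition _ := [isSub for subfield_val].
HB.instance Definition _ := [Choice of subfield_of by <:].
HB.instance Definition _ := [SubChoice_isSubComUnitRing of subfield_of by <:].
HB.instance Definition _ :=
  [SubComUnitRing_isSubIntegralDomain of subfield_of by <:].
HB.instance Definition _ := [SubIntegralDomain_isSubField of subfield_of by <:].

Hypothesis nosq : forall z : F, z ^+ 2 != -1.
Hypothesis sqV : forall a : F, exists z, z ^+ 2 = a \/ z ^+ 2 = - a.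
Hypothesis sqrtS : forall z : F, z ^+ 2 \in S -> z \in S.
Hypothesis sqD : forall x y : F, x \in S -> y \in S ->
  exists z : F, x ^+ 2 + y ^+ 2 = z ^+ 2.
Hypothesis oddS : forall P : {poly F}, P \is a polyOver S -> P \is monic ->
  ~~ odd (size P) -> exists2 x, x \in S & root P x.

(** The root z ranges over all of F, as in [lep]; [sqrtS] brings it back into S, where [sqD] can be
    applied. *)
Let le (x y : subfield_of) : bool := `[< exists z : F, z ^+ 2 = val y - val x >].
Let lt x y := (y != x) && le x y.
Let norm x := if le 0 x then x else - x.

Let le0P x : reflect (exists2 z : F, z \in S & z ^+ 2 = val x) (le 0 x).
Proof.
apply: (iffP (asboolP _)) => [[z]|[z _ zx]]; rewrite rmorph0 subr0.
  by move=> zx; exists z => //; apply: sqrtS; rewrite zx (valP x).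
by exists z.
Qed.

Let le0_add x y : le 0 x -> le 0 y -> le 0 (x + y).
Proof.
move=> /le0P[u uS ux] /le0P[v vS vy]; have [z uvz] := sqD uS vS.
by apply/asboolP; exists z; rewrite -uvz ux vy rmorph0 subr0 rmorphD.
Qed.

Let le0_mul x y : le 0 x -> le 0 y -> le 0 (x * y).
Proof.
move=> /le0P[u uS ux] /le0P[v vS vy].
by apply/asboolP; exists (u * v); rewrite exprMn ux vy rmorph0 subr0 rmorphM.
Qed.

Let sub_ge0 x y : le 0 (y - x) = le x y.
Proof. by rewrite /le rmorph0 subr0 rmorphB. Qed.

Let le0N x : le 0 (- x) = le x 0.
Proof. by rewrite -[RHS]sub_ge0 sub0r. Qed.

(** If x and - x were both nonzero squares, the quotient of their roots would square to -1. *)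
Let le0_anti x : le 0 x -> le x 0 -> x = 0.
Proof.
rewrite -le0N => /le0P[u _ ux] /le0P[v _]; rewrite rmorphN => vx.
have {}vx : v ^+ 2 = - u ^+ 2 by rewrite vx ux.
apply: val_inj; apply: contrapT => /eqP x0.
have u0 : u != 0 by apply: contraNneq x0 => u0; rewrite -ux u0 expr0n rmorph0.
by case/eqP: (nosq (v / u)); rewrite expr_div_n vx mulNr divff ?expf_neq0.
Qed.

Let le0_total x : le 0 x || le x 0.
Proof.
apply/orP; have [z [zx|zx]] := sqV (val x).
  by left; apply/asboolP; exists z; rewrite zx rmorph0 subr0.
by right; apply/asboolP; exists z; rewrite zx rmorph0 sub0r.
Qed.

Let normN x : norm (- x) = norm x.
Proof.
rewrite /norm le0N; have := le0_total x; have := @le0_anti x.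
case: (le 0 x); case: (le x 0) => //= [/(_ isT isT)->|]; by rewrite ?opprK ?oppr0.
Qed.

Let ge0_norm x : le 0 x -> norm x = x.
Proof. by rewrite /norm => ->. Qed.

Let ordered := Num.IntegralDomain_isLeReal.Build subfield_of
  le0_add le0_mul le0_anti sub_ge0 le0_total normN ge0_norm (fun x y => erefl (lt x y)).
Let Rfield : realFieldType := HB.pack subfield_of ordered.

Let odd_root (P : {poly Rfield}) : P != 0 -> ~~ odd (size P) -> exists x, root P x.
Proof.
move=> P0 oddP; pose v : {rmorphism Rfield -> F} := val.
wlog Pm : P P0 oddP / P \is monic.
  have c0 : (lead_coef P)^-1 != 0 by rewrite invr_eq0 lead_coef_eq0.
  move=> /(_ ((lead_coef P)^-1 *: P)); rewrite scaler_eq0 negb_or c0 P0 size_scale //.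
  move=> /(_ isT oddP); rewrite monicE lead_coefZ mulVf ?lead_coef_eq0 // eqxx.
  by move=> [//|x]; rewrite rootZ // => Px; exists x.
have [|||x xS Px] := oddS (P := map_poly v P).
- by apply/polyOverP => i; rewrite coef_map; apply: valP.
- by rewrite map_monic.
- by rewrite size_map_poly.
by exists (Subfield_of xS : Rfield); rewrite -(fmorph_root v).
Qed.

Lemma rcf_of_subfield : exists (R : rcfType) (h : {rmorphism R -> F}),
  (forall x, x \in S <-> exists r, h r = x) /\
  (forall x y, x <= y <-> exists z, z ^+ 2 = h y - h x).
Proof.
have sqrtR (x : Rfield) : 0 <= x -> exists y, y ^+ 2 = x.
  move=> /le0P[z zS zx]; exists (Subfield_of zS : Rfield).
  by apply: val_inj; rewrite rmorphXn.
pose ax := Num.RealField_isClosed.Build Rfield (poly_ivt_of_sqrt_odd sqrtR odd_root).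
pose R : rcfType := HB.pack subfield_of Rfield ax.
exists R, (val : {rmorphism subfield_of -> F}); split=> [x|x y].
  split=> [xS|[r <-]]; last exact: valP.
  by exists (Subfield_of xS : R).
have P := asboolP (exists z, z ^+ 2 = val y - val x).
by split; [move/P|move=> Q; apply/P].
Qed.
End OrderedSubfield.
End RealClosedAlgebra.

(** * From countable order gaps to saturation of a real closed field *)

Section Saturation.
Local Open Scope ring_scope.
Local Open Scope classical_set_scope.

Section CountableFormulas.
Variables (R : realDomainType) (A : set R) (c : R -> nat).
Hypothesis c_inj : {in A &, injective c}.

(** Constants are coded by an enumeration [c] of the parameter set, so injectivity holds only for
    terms with parameters in A; R itself may be uncountable. *)
Fixpoint term_code (t : GRing.term R) : GenTree.tree nat :=
  match t with
  | GRing.Var n => GenTree.Node 0 [:: GenTree.Leaf n]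
  | GRing.Const x => GenTree.Node 1 [:: GenTree.Leaf (c x)]
  | GRing.NatConst n => GenTree.Node 2 [:: GenTree.Leaf n]
  | GRing.Add t1 t2 => GenTree.Node 3 [:: term_code t1; term_code t2]
  | GRing.Opp t1 => GenTree.Node 4 [:: term_code t1]
  | GRing.NatMul t1 n => GenTree.Node 5 [:: term_code t1; GenTree.Leaf n]
  | GRing.Mul t1 t2 => GenTree.Node 6 [:: term_code t1; term_code t2]
  | GRing.Inv t1 => GenTree.Node 7 [:: term_code t1]
  | GRing.Exp t1 n => GenTree.Node 8 [:: term_code t1; GenTree.Leaf n]
  end.

Fixpoint formula_code (f : ord.formula R) : GenTree.tree nat :=
  match f with
  | ord.Bool b => GenTree.Node 0 [:: GenTree.Leaf (b : nat)]
  | ord.Unit t => GenTree.Node 1 [:: term_code t]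
  | ord.Equal t1 t2 => GenTree.Node 2 [:: term_code t1; term_code t2]
  | ord.Lt t1 t2 => GenTree.Node 3 [:: term_code t1; term_code t2]
  | ord.Le t1 t2 => GenTree.Node 4 [:: term_code t1; term_code t2]
  | ord.And f1 f2 => GenTree.Node 5 [:: formula_code f1; formula_code f2]
  | ord.Or f1 f2 => GenTree.Node 6 [:: formula_code f1; formula_code f2]
  | ord.Implies f1 f2 => GenTree.Node 7 [:: formula_code f1; formula_code f2]
  | ord.Not f1 => GenTree.Node 8 [:: formula_code f1]
  | ord.Exists n f1 => GenTree.Node 9 [:: GenTree.Leaf n; formula_code f1]
  | ord.Forall n f1 => GenTree.Node 10 [:: GenTree.Leaf n; formula_code f1]
  end.

Lemma term_code_inj : {in [set t | term_params t `<=` A] &, injective term_code}.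
Proof.
move=> t u; rewrite !inE; elim: t u => [n|x|n|t1 IH1 t2 IH2|t1 IH1|t1 IH1 n|t1 IH1 t2 IH2|t1 IH1|t1 IH1 n]
  [m|y|m|u1 u2|u1|u1 m|u1 u2|u1|u1 m] //=.
- by move=> _ _ [->].
- by move=> xA yA [/c_inj->] //; rewrite inE; [apply: xA|apply: yA].
- by move=> _ _ [->].
- by rewrite !subUset => -[? ?] [? ?] [/IH1-> // /IH2->].
- by move=> ? ? [/IH1->].
- by move=> ? ? [/IH1-> // ->].
- by rewrite !subUset => -[? ?] [? ?] [/IH1-> // /IH2->].
- by move=> ? ? [/IH1->].
- by move=> ? ? [/IH1-> // ->].
Qed.

Lemma formula_code_inj :
  {in [set f | formula_params f `<=` A] &, injective formula_code}.
Proof.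
have tI t u : term_params t `<=` A -> term_params u `<=` A ->
    term_code t = term_code u -> t = u.
  by move=> tA uA /term_code_inj-> //; rewrite inE.
move=> f g; rewrite !inE; elim: f g => [b|t1 t2|t1 t2|t1 t2|t|f1 IH1 f2 IH2|f1 IH1 f2 IH2|f1 IH1 f2 IH2|f1 IH1|n f1 IH1|n f1 IH1]
  [b'|u1 u2|u1 u2|u1 u2|u|g1 g2|g1 g2|g1 g2|g1|m g1|m g1] //=;
  rewrite ?subUset.
- by case: b b' => -[].
- by move=> -[? ?] [? ?] [/tI-> // /tI->].
- by move=> -[? ?] [? ?] [/tI-> // /tI->].
- by move=> -[? ?] [? ?] [/tI-> // /tI->].
- by move=> ? ? [/tI->].
- by move=> -[? ?] [? ?] [/IH1-> // /IH2->].
- by move=> -[? ?] [? ?] [/IH1-> // /IH2->].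
- by move=> -[? ?] [? ?] [/IH1-> // /IH2->].
- by move=> ? ? [/IH1->].
- by move=> ? ? [-> /IH1->].
- by move=> ? ? [-> /IH1->].
Qed.

End CountableFormulas.

Lemma countable_formulas (R : realDomainType) (A : set R) :
  countable A -> countable [set f : ord.formula R | formula_params f `<=` A].
Proof.
move=> /countable_injP[c cI]; apply/countable_injP.
exists (fun f => pickle (formula_code c f)) => f g fA gA /(pcan_inj pickleK).
exact: (formula_code_inj cI).
Qed.

(** Both comparisons are recorded because an endpoint is a cell by itself: together they give x = e
    exactly when y = e. *)
Definition same_cell (R : realDomainType) (E : seq R) (x y : R) : Prop :=
  forall e, e \in E -> (x < e) = (y < e) /\ (e < x) = (e < y).

Lemma same_cellC (R : realDomainType) (E : seq R) x y :
  same_cell E x y -> same_cell E y x.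
Proof. by move=> xy e /xy[-> ->]. Qed.

Lemma same_cell_cat (R : realDomainType) (E E' : seq R) x y :
  same_cell (E ++ E') x y -> same_cell E x y /\ same_cell E' x y.
Proof. by move=> xy; split=> e eE; apply: xy; rewrite mem_cat eE ?orbT. Qed.

(** The endpoints are the roots of P. Unless P has the same nonzero sign at x and y, there is a root
    between them, and lying in one cell forces both to equal that root. *)
Lemma sgr_same_cell (R : rcfType) (P : {poly R}) :
  exists E, forall x y, same_cell E x y -> Num.sg P.[x] = Num.sg P.[y].
Proof.
have [->|P0] := eqVneq P 0; first by exists [::] => x y _; rewrite !horner0.
exists (rootsR P) => x y.
wlog xy : x y / x <= y => [wl|] cell.
  by have [/wl|/ltW/wl H] := leP x y; [exact|rewrite H //; apply: same_cellC].
have [Pxy|Pxy] := ltP 0 (P.[x] * P.[y]).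
  have : Num.sg (P.[x] * P.[y]) = 1 by rewrite gtr0_sg.
  rewrite sgrM; case: (sgrP P.[x]); case: (sgrP P.[y]) => //; rewrite ?mulr0 ?mul0r; lra.
have [r /andP[xr ry] Pr] := polyrcf.poly_ivt xy Pxy.
have /cell[] : r \in rootsR P.
  by rewrite -(roots_on_rootsR P0) Pr in_itv.
rewrite !bnd_simp in xr ry.
rewrite (le_gtF ry) (le_gtF xr) => rx ry'.
have -> : x = r by apply/eqP; rewrite eq_le xr /= leNgt rx.
by have -> : y = r by apply/eqP; rewrite eq_le ry /= leNgt -ry'.
Qed.

Lemma rterm_horner (R : rcfType) (t : GRing.term R) : GRing.rterm t ->
  exists P : {poly R}, forall x, GRing.eval [:: x] t = P.[x].
Proof.
elim: t => [n|c|n|t1 IH1 t2 IH2|t1 IH1|t1 IH1 n|t1 IH1 t2 IH2|t1 IH1|t1 IH1 n] //=.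
- case: n => [|n] _; first by exists 'X => x; rewrite hornerX.
  by exists 0 => x; rewrite /= nth_nil horner0.
- by move=> _; exists c%:P => x; rewrite hornerC.
- by move=> _; exists n%:R => x; rewrite -polyC_natr hornerC.
- by move=> /andP[/IH1[P eP] /IH2[Q eQ]]; exists (P + Q) => x; rewrite eP eQ hornerD.
- by move=> /IH1[P eP]; exists (- P) => x; rewrite eP hornerN.
- by move=> /IH1[P eP]; exists (P *+ n) => x; rewrite eP hornerMn.
- by move=> /andP[/IH1[P eP] /IH2[Q eQ]]; exists (P * Q) => x; rewrite eP eQ hornerM.
- by move=> /IH1[P eP]; exists (P ^+ n) => x; rewrite eP horner_exp.
Qed.

Lemma qf_same_cell (R : rcfType) (f : ord.formula R) : ord.rformula f ->
  exists E, forall x y, same_cell E x y ->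
    ord.qf_eval [:: x] f = ord.qf_eval [:: y] f.
Proof.
have tsg (t u : GRing.term R) : GRing.rterm t && GRing.rterm u -> exists E, forall x y,
    same_cell E x y -> Num.sg (GRing.eval [:: x] t - GRing.eval [:: x] u) =
      Num.sg (GRing.eval [:: y] t - GRing.eval [:: y] u).
  move=> /andP[/rterm_horner[P eP] /rterm_horner[Q eQ]].
  have [E PE] := sgr_same_cell (P - Q); exists E => x y /PE.
  by rewrite !eP !eQ !hornerE.
elim: f => [b|t1 t2|t1 t2|t1 t2|t|f1 IH1 f2 IH2|f1 IH1 f2 IH2|f1 IH1 f2 IH2|f1 IH1|n f1 IH1|n f1 IH1] //=.
- by exists [::].
- by move=> /tsg[E tE]; exists E => x y /tE H; rewrite -subr_eq0 -sgr_eq0 H sgr_eq0 subr_eq0.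
- by move=> /tsg[E tE]; exists E => x y /tE H; rewrite -subr_lt0 -sgr_lt0 H sgr_lt0 subr_lt0.
- by move=> /tsg[E tE]; exists E => x y /tE H; rewrite -subr_le0 -sgr_le0 H sgr_le0 subr_le0.
- move=> /andP[/IH1[E1 H1] /IH2[E2 H2]]; exists (E1 ++ E2) => x y /same_cell_cat[? ?].
  by rewrite (H1 x y) // (H2 x y).
- move=> /andP[/IH1[E1 H1] /IH2[E2 H2]]; exists (E1 ++ E2) => x y /same_cell_cat[? ?].
  by rewrite (H1 x y) // (H2 x y).
- move=> /andP[/IH1[E1 H1] /IH2[E2 H2]]; exists (E1 ++ E2) => x y /same_cell_cat[? ?].
  by rewrite (H1 x y) // (H2 x y).
- by move=> /IH1[E H]; exists E => x y /H->.
- by exists [::].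
- by exists [::].
Qed.

(** [to_rform] removes inverses, so each atom left after elimination is a sign condition on a
    one-variable polynomial. *)
Lemma holds_same_cell (R : rcfType) (f : ord.formula R) :
  exists E, forall x y, same_cell E x y -> ord.holds [:: x] f -> ord.holds [:: y] f.
Proof.
pose g := ord.quantifier_elim (@wproj R) (ord.to_rform f).
have /andP[_ rg] := ord.quantifier_elim_wf (@wf_QE_wproj R) (ord.to_rform_rformula f).
have [E EP] := qf_same_cell rg.
exists E => x y xy /rcf_satP; rewrite /rcf_sat /ord.proj_sat => H.
by apply/rcf_satP; rewrite /rcf_sat /ord.proj_sat -(EP x y xy).
Qed.

(** Hausdorff's eta_1 condition. Since A or B may be empty, it also says that no countable set is
    cofinal or coinitial. *)
Definition eta1 (R : realDomainType) : Prop :=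
  forall A B : set R, countable A -> countable B ->
    (forall a b, A a -> B b -> a < b) ->
  exists x, (forall a, A a -> a < x) /\ (forall b, B b -> x < b).

Lemma filter_all_seq (T : Type) (U : eqType) (F : set_system T) (FF : Filter F)
    (s : seq U) (P : U -> set T) :
  (forall e, e \in s -> F (P e)) -> F [set n | forall e, e \in s -> P e n].
Proof.
elim: s => [|e s IHs] FP; first exact: filterE.
have Fs : F [set n | forall e, e \in s -> P e n].
  by apply: IHs => u us; apply: FP; rewrite inE us orbT.
apply: filterS2 (FP e (mem_head _ _)) Fs => n Pn sn u.
by rewrite inE => /predU1P[->//|/sn].
Qed.

(* Phi is countable, so the cells of all its formulas have countably many
   endpoints, wherever the constants of the eliminated formulas come from.  An
   ultrafilter on the finite approximations selects a side of each endpoint. *)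
Lemma eta1_saturated (R : rcfType) : eta1 R -> aleph1_saturated R.
Proof.
move=> eta A Phi cA PhiA finPhi.
have cPhi : countable Phi by apply: sub_countable (countable_formulas cA); apply: subset_card_le.
have [g gI] := countable_injP _ cPhi.
have [E EP] := choice (@holds_same_cell R).
have xP n : exists x, forall f, Phi f -> (g f <= n)%N -> ord.holds [:: x] f.
  pose S := [set f | Phi f /\ (g f <= n)%N].
  have [|f [] //|x xS] := finPhi S; last by exists x => f fP fn; apply: xS.
  have SPhi : {in S &, injective g}.
    by move=> f f' /set_mem[? _] /set_mem[? _]; apply: gI; apply: mem_set.
  rewrite -(eq_finite_set (inj_card_eq SPhi)).
  by apply: sub_finite_set (finite_II n.+1) => _ [f [_ fn] <-].
have [x {}xP] := choice xP.
have [G [GU Goo]] := ultraFilterLemma eventually_filter.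
have Gn n : G [set m | (n <= m)%N] by apply: Goo; exists n.
have GF : ProperFilter G by exact: ultra_proper.
(* If G makes the approximations constantly e, then e realises the type. Otherwise G puts every
   endpoint strictly on one side of them, and the two classes of endpoints form a countable gap. *)
have [[e Ge]|noE] := pselect (exists e, G [set n | x n = e]).
  exists e => f Phif; have [n [<- fn]] := filter_ex (filterI Ge (Gn (g f))).
  exact: xP.
pose Etot := \bigcup_(f in Phi) [set` E f].
have cE : countable Etot.
  by apply: bigcup_countable => // f _; apply: finite_set_countable.
pose lo e := G [set n | e < x n]; pose hi e := G [set n | x n < e].
have lohi e : lo e \/ hi e.
  have [?|] := in_ultra_setVsetC [set n | e < x n] GU; first by left.
  move=> nlo; right.
  have [Ge|neq] := in_ultra_setVsetC [set n | x n = e] GU.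
    by case: noE; exists e.
  apply: filterS2 nlo neq => n /= /negP; rewrite -leNgt le_eqVlt => /predU1P[->|//].
  by move=> /(_ erefl).
have subc (A' : set R) : countable (Etot `&` A').
  by apply: sub_countable cE; apply: subset_card_le => ? [].
have [a b [_ la] [_ hb]|z [zA zB]] := eta (Etot `&` lo) (Etot `&` hi) (subc _) (subc _).
  by have [n [/= an nb]] := filter_ex (filterI la hb); apply: lt_trans nb.
exists z => f Phif.
have Gcell : G [set n | forall e, e \in E f -> (x n < e) = (z < e) /\ (e < x n) = (e < z)].
  apply: filter_all_seq => e ef.
  have eE : Etot e by exists f.
  have [le|he] := lohi e.
    apply: filterS (le) => n /= xn; have ze := zA e (conj eE le).
    by rewrite xn ze (lt_gtF xn) (lt_gtF ze).
  apply: filterS (he) => n /= xn; have ze := zB e (conj eE he).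
  by rewrite xn ze (lt_gtF xn) (lt_gtF ze).
have [n [/= xz fn]] := filter_ex (filterI Gcell (Gn (g f))).
exact: (EP f _ _ xz (xP n f Phif fn)).
Qed.

End Saturation.

(** * Heights over a field, measured by integer matrices and a common eigenvector *)

Section Height.
Local Open Scope ring_scope.
Variable K : fieldType.

(** v is a left eigenvector of an integer matrix, for the eigenvalue c a. Keeping v fixed turns sums
    and products of eigenvalues into sums and products of matrices; the index type T is arbitrary so
    that tensor products are indexed by pairs. *)
Definition int_acts (T : finType) (v : T -> K) (c m : nat) (a : K) : Prop :=
  exists A : T -> T -> int, (forall s t, (`|A s t| <= m)%N) /\
    forall t, \sum_s v s * (A s t)%:~R = c%:R * a * v t.

Lemma int_acts_le T v c m m' a : (m <= m')%N ->
  @int_acts T v c m a -> int_acts v c m' a.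
Proof. by move=> mm' [A [Am Av]]; exists A; split=> // s t; apply: leq_trans mm'. Qed.

Lemma int_actsD T v c m m' a b : @int_acts T v c m a -> int_acts v c m' b ->
  int_acts v c (m + m') (a + b).
Proof.
move=> [A [Am Av]] [B [Bm Bv]]; exists (fun s t => A s t + B s t); split=> [s t|t].
  by apply: leq_trans (leq_add (Am s t) (Bm s t)); lia.
rewrite mulrDr mulrDl -Av -Bv -big_split; apply: eq_bigr => s _.
by rewrite rmorphD mulrDr.
Qed.

Lemma int_actsN T v c m a : @int_acts T v c m a -> int_acts v c m (- a).
Proof.
move=> [A [Am Av]]; exists (fun s t => - A s t); split=> [s t|t].
  by rewrite abszN.
rewrite mulrN mulNr -Av -sumrN; apply: eq_bigr => s _.
by rewrite rmorphN mulrN.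
Qed.

Lemma leq_absz_sum (I : finType) (f : I -> int) (m : nat) :
  (forall i, (`|f i| <= m)%N) -> (`|(\sum_i f i)%R| <= #|I| * m)%N.
Proof.
move=> fm; suff : (`|(\sum_i f i)%R| <= \sum_(i : I) m)%N by rewrite sum_nat_const.
elim/big_ind2 : _ => // x1 x2 y1 y2 H1 H2; lia.
Qed.

Lemma int_actsM T v c d m m' a b : @int_acts T v c m a -> int_acts v d m' b ->
  int_acts v (c * d) (#|T| * (m * m')) (a * b).
Proof.
move=> [A [Am Av]] [B [Bm Bv]].
exists (fun s t => \sum_u A s u * B u t); split=> [s t|t].
  by apply: leq_absz_sum => u; rewrite abszM leq_mul.
transitivity (\sum_u \sum_s v s * (A s u)%:~R * (B u t)%:~R).
  rewrite exchange_big; apply: eq_bigr => s _ /=.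
  rewrite rmorph_sum mulr_sumr; apply: eq_bigr => u _.
  by rewrite rmorphM mulrA.
transitivity (\sum_u c%:R * a * (v u * (B u t)%:~R)).
  by apply: eq_bigr => u _; rewrite -mulr_suml Av mulrA.
by rewrite -mulr_sumr Bv natrM; ring.
Qed.

Definition tens (T U : finType) (v : T -> K) (w : U -> K) (p : T * U) : K :=
  v p.1 * w p.2.

(** The matrix is A tensored with d times the identity: the scaling by d gives both tensor factors
    the same denominator c d. *)
Lemma int_acts_tensl T (U : finType) v (w : U -> K) c d m a : @int_acts T v c m a ->
  int_acts (tens v w) (c * d) (m * d) a.
Proof.
move=> [A [Am Av]].
exists (fun p q => if p.2 == q.2 then A p.1 q.1 * d%:Z else 0); split=> [p q|q].
  by case: ifP => // _; rewrite abszM leq_mul.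
rewrite -(pair_bigA _ (fun s u => tens v w (s, u) *
   (if u == q.2 then A s q.1 * d%:Z else 0)%:~R)) /=.
under eq_bigr => s _.
  rewrite (bigD1 q.2) //= eqxx big1 ?addr0; last first.
    by move=> u /negPf->; rewrite mulr0.
  over.
transitivity (d%:R * w q.2 * \sum_s v s * (A s q.1)%:~R).
  by rewrite mulr_sumr; apply: eq_bigr => s _; rewrite rmorphM /tens /=; ring.
by rewrite Av natrM /tens; ring.
Qed.

Lemma int_acts_tensr (T U : finType) v (w : U -> K) c d m a : @int_acts U w d m a ->
  int_acts (@tens T U v w) (c * d) (c * m) a.
Proof.
move=> [A [Am Av]].
exists (fun p q => if p.1 == q.1 then c%:Z * A p.2 q.2 else 0); split=> [p q|q].
  by case: ifP => // _; rewrite abszM leq_mul.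
rewrite -(pair_bigA _ (fun s u => tens v w (s, u) *
   (if s == q.1 then c%:Z * A u q.2 else 0)%:~R)) /=.
rewrite (bigD1 q.1) //= [X in _ + X]big1 ?addr0; last first.
  by move=> u /negPf ->; rewrite big1 // => *; rewrite mulr0.
rewrite eqxx.
transitivity (c%:R * v q.1 * \sum_s w s * (A s q.2)%:~R).
  by rewrite mulr_sumr; apply: eq_bigr => s _; rewrite rmorphM /tens /=; ring.
by rewrite Av natrM /tens; ring.
Qed.

(* The matrix below is the block companion matrix of the polynomial, scaled by c. *)
Lemma int_acts_root T v c m d (a : 'I_d -> K) x :
    (forall i, @int_acts T v c m (a i)) ->
    x ^+ d + \sum_i a i * x ^+ i = 0 ->
  int_acts (@tens 'I_d T (fun i => x ^+ i) v) c (maxn c m) x.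
Proof.
move=> /choice[A Aa] xa.
exists (fun p q : 'I_d * T => if (q.1.+1 < d)%N then
    (if (p.1 == q.1.+1 :> nat) && (p.2 == q.2) then c%:Z else 0)
  else - A p.1 p.2 q.2); split=> [p q|[k t]] /=.
  case: ifP => _; first by case: ifP => // _; rewrite leq_maxl.
  by rewrite abszN leq_max (Aa _).1 orbT.
rewrite -(pair_bigA _ (fun (i : 'I_d) u => tens (fun i : 'I_d => x ^+ i) v (i, u) *
   (if (k.+1 < d)%N then (if (i == k.+1 :> nat) && (u == t) then c%:Z else 0)
  else - A i u t)%:~R)) /=.
have [kd|kd] := ltnP k.+1 d.
  rewrite (bigD1 (Ordinal kd)) //= [X in _ + X]big1 ?addr0; last first.
    by move=> i /negPf; rewrite -val_eqE /= => ->; rewrite big1 // => *; rewrite mulr0.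
  rewrite eqxx (bigD1 t) //= eqxx big1 ?addr0; last first.
    by move=> u /negPf ->; rewrite mulr0.
  by rewrite /tens /= exprS; ring.
have dk : d = k.+1 by apply/eqP; rewrite eqn_leq kd ltn_ord.
transitivity (\sum_(i < d) - (x ^+ i * (c%:R * a i * v t))).
  apply: eq_bigr => i _; rewrite -(Aa i).2 mulr_sumr -sumrN; apply: eq_bigr => s _.
  by rewrite /tens /= rmorphN /=; ring.
rewrite /tens /= [RHS](_ : _ = c%:R * v t * x ^+ d); last first.
  by rewrite [in RHS]dk exprS; ring.
have -> : x ^+ d = - \sum_i a i * x ^+ i by apply/eqP; rewrite -addr_eq0 xa.
rewrite mulrN mulr_sumr sumrN; congr (- _); apply: eq_bigr => i _; ring.
Qed.

(** Dimension and logarithmic size are kept apart because they grow differently; [fQbar] controls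
    both, being their sum. *)
Definition height_le (n e : nat) (x : K) : Prop :=
  exists (T : finType) (v : T -> K) (c m : nat),
    [/\ (exists t, v t != 0) /\ c%:R != 0 :> K, (#|T| <= n)%N,
        (c <= 2 ^ e)%N, (m <= 2 ^ e)%N & int_acts v c m x].

Lemma height_le_leq n n' e e' x : (n <= n')%N -> (e <= e')%N ->
  height_le n e x -> height_le n' e' x.
Proof.
move=> nn' ee' [T [v [c [m [v0 Tn ce me xv]]]]]; exists T, v, c, m.
have ee2 : (2 ^ e <= 2 ^ e')%N by rewrite leq_exp2l.
by split=> //; [apply: leq_trans nn'|apply: leq_trans ee2..].
Qed.

Lemma tens_neq0 (T U : finType) (v : T -> K) (w : U -> K) :
  (exists t, v t != 0) -> (exists u, w u != 0) -> exists p, tens v w p != 0.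
Proof. by move=> [t vt] [u wu]; exists (t, u); rewrite mulf_neq0. Qed.

Lemma height_leN n e x : height_le n e x -> height_le n e (- x).
Proof.
move=> [T [v [c [m [v0 Tn ce me xv]]]]]; exists T, v, c, m; split=> //.
exact: int_actsN.
Qed.

Lemma height_leD n n' e e' x y : height_le n e x -> height_le n' e' y ->
  height_le (n * n') (e + e').+1 (x + y).
Proof.
move=> [T [v [c [m [[v0 c0] Tn ce me xv]]]]] [U [w [d [l [[w0 d0] Un de le yw]]]]].
exists (T * U)%type, (tens v w), (c * d)%N, (m * d + c * l)%N; split.
- by split; [apply: tens_neq0|rewrite natrM mulf_neq0].
- by rewrite card_prod leq_mul.
- by apply: leq_trans (leq_mul ce de) _; rewrite -expnD leq_exp2l.
(* The two summands are each at most 2 ^ (e + e'), whence the successor in the exponent. *)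
- rewrite expnS expnD mul2n -addnn leq_add // leq_mul //.
- exact: int_actsD (int_acts_tensl _ _ xv) (int_acts_tensr _ _ yw).
Qed.

(** The common denominator c d enters twice, which doubles e + e'; matrix multiplication adds the
    factor #|T| #|U|, absorbed into the exponent as n + n' through n < 2 ^ n. *)
Lemma height_leM n n' e e' x y : height_le n e x -> height_le n' e' y ->
  height_le (n * n') (n + n' + (e + e') * 2) (x * y).
Proof.
move=> [T [v [c [m [[v0 c0] Tn ce me xv]]]]] [U [w [d [l [[w0 d0] Un de le yw]]]]].
exists (T * U)%type, (tens v w), ((c * d) * (c * d))%N,
  (#|{: T * U}| * ((m * d) * (c * l)))%N; split.
- by split; [apply: tens_neq0|rewrite !natrM !mulf_neq0].
- by rewrite card_prod leq_mul.
- apply: leq_trans (leq_mul (leq_mul ce de) (leq_mul ce de)) _.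
  by rewrite -!expnD leq_exp2l // muln2 -addnn leq_addl.
- rewrite expnD card_prod; apply: leq_mul.
    by rewrite expnD; apply: leq_mul; [apply: leq_trans Tn _|apply: leq_trans Un _];
      rewrite ltnW // ltn_expl.
  apply: leq_trans (leq_mul (leq_mul me de) (leq_mul ce le)) _.
  by rewrite -!expnD leq_exp2l // muln2 -addnn.
- exact: int_actsM (int_acts_tensl _ _ xv) (int_acts_tensr _ _ yw).
Qed.

(** The block companion matrix needs all coefficients to act on one vector with one denominator;
    iterated tensoring provides them. *)
Lemma joint_int_acts n e d (a : 'I_d -> K) : (forall i, height_le n e (a i)) ->
  exists (T : finType) (v : T -> K) (c m : nat),
    [/\ (exists t, v t != 0) /\ c%:R != 0 :> K, (#|T| <= n ^ d)%N,
        (c <= 2 ^ (e * d))%N, (m <= 2 ^ (e * d))%N &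
        forall i, int_acts v c m (a i)].
Proof.
elim: d a => [|d IHd] a ha.
  exists unit, (fun=> 1), 1%N, 1%N; rewrite muln0 card_unit; split=> //; last by case.
  by split; [exists tt|]; rewrite oner_eq0.
have [T [v [c [m [[v0 c0] Tn ce me xv]]]]] := IHd _ (fun i => ha (lift ord0 i)).
have [U [w [b [l [[w0 b0] Un be le yw]]]]] := ha ord0.
exists (T * U)%type, (tens v w), (c * b)%N, (maxn (m * b) (c * l)); split.
- by split; [apply: tens_neq0|rewrite natrM mulf_neq0].
- by rewrite card_prod expnS mulnC leq_mul.
- by rewrite mulnS addnC expnD leq_mul.
- by rewrite mulnS addnC expnD geq_max !leq_mul.
- move=> i; case: (unliftP ord0 i) => [j ->|->].
    by apply: int_acts_le (int_acts_tensl _ _ (xv j)); rewrite leq_maxl.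
  by apply: int_acts_le (int_acts_tensr _ _ yw); rewrite leq_maxr.
Qed.

Lemma height_le_root n e d (a : 'I_d -> K) x : (0 < d)%N ->
    (forall i, height_le n e (a i)) -> x ^+ d + \sum_i a i * x ^+ i = 0 ->
  height_le (d * n ^ d) (e * d) x.
Proof.
move=> d0 /joint_int_acts[T [v [c [m [[v0 c0] Tn ce me xv]]]]] xa.
exists ('I_d * T)%type, (tens (fun i : 'I_d => x ^+ i) v), c, (maxn c m); split=> //.
- by split=> //; apply: tens_neq0 => //; exists (Ordinal d0); rewrite oner_eq0.
- by rewrite card_prod card_ord leq_mul2l Tn orbT.
- by rewrite geq_max ce.
- exact: int_acts_root xa.
Qed.

(** After division by the leading coefficient z, the coefficients share the denominator |z| and act
    on a one-dimensional space, so neither the dimension nor the exponent suffers from tensoring. *)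
Lemma height_le_poly e (Q : {poly K}) x : Q != 0 -> root Q x ->
    (forall k, exists2 z : int, Q`_k = z%:~R & (`|z| <= 2 ^ e)%N) ->
  height_le (size Q).-1 e x.
Proof.
move=> Q0 Qx Qe; have sQ := root_size_gt1 Q0 Qx.
have [z lz ze] := Qe (size Q).-1.
have z0 : `|z|%N%:R != 0 :> K.
  have : lead_coef Q != 0 by rewrite lead_coef_eq0.
  rewrite lead_coefE lz; case: (intP z) => [|k|k]; rewrite ?abszN //.
  by rewrite rmorphN oppr_eq0.
set d := (size Q).-1 in lz *.
have Qd : size Q = d.+1 by rewrite /d prednK // ltnW.
have d0 : (0 < d)%N by rewrite -ltnS -Qd.
pose a (i : 'I_d) := Q`_i / z%:~R.
have xa : x ^+ d + \sum_i a i * x ^+ i = 0.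
  have z0' : z%:~R != 0 :> K by rewrite -lz -lead_coefE lead_coef_eq0.
  have := rootP Qx; rewrite horner_coef Qd big_ord_recr /= lz => /(congr1 (fun y => y / z%:~R)).
  rewrite mul0r mulrDl mulr_suml mulrAC divff // mul1r => xz.
  rewrite -[RHS]xz addrC; congr (_ + _); apply: eq_bigr => i _; exact: mulrAC.
(* Denominators are natural numbers, so the sign of z moves to the numerator: |z| (y / z) = sgz z *
   y. *)
have act1 i : @int_acts unit (fun=> 1) `|z|%N (2 ^ e) (a i).
  have [y yQ ye] := Qe i; exists (fun _ _ => sgz z * y); split=> [_ _|_].
    rewrite abszM; apply: leq_trans ye.
    by case: (sgzP z) => _; rewrite ?mul0n ?abszN ?mul1n.
  rewrite big_const card_unit /= addr0 mul1r mulr1 /a yQ mulrCA mulrC.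
  rewrite rmorphM; congr (_ * _).
  have -> : `|z|%N%:R = (sgz z)%:~R * z%:~R :> K.
    by rewrite -rmorphM /= pmulrn abszEsg.
  by rewrite mulfK // -lz -lead_coefE lead_coef_eq0.
exists ('I_d * unit)%type, (tens (fun i : 'I_d => x ^+ i) (fun=> 1)), `|z|%N, (maxn `|z|%N (2 ^ e)).
split=> //.
- split=> //; apply: tens_neq0; last by exists tt; rewrite oner_eq0.
  by exists (Ordinal d0); rewrite oner_eq0.
- by rewrite card_prod card_ord card_unit muln1.
- by rewrite geq_max ze leqnn.
- exact: int_acts_root xa.
Qed.

Lemma height_le1 : height_le 1 0 1.
Proof.
exists unit, (fun=> 1), 1%N, 1%N; rewrite card_unit; split=> //.
  by split; [exists tt|]; rewrite oner_eq0.
exists (fun _ _ => 1); split=> // t.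
by rewrite big_const card_unit /= addr0 !mulr1.
Qed.

(* The coefficients of the Leibniz sum are dominated by those of n`! ('X + m)^n,
   hence by its value at 1. *)
Lemma coef_char_poly_bound n m (M : 'M[int]_n) :
    (forall i j, (`|M i j| <= m)%N) ->
  forall k, (`|((char_poly M)`_k)%R| <= n ^ n * m.+1 ^ n)%N.
Proof.
move=> Mm.
pose maj (P Q : {poly int}) := forall k, `|P`_k| <= Q`_k.
have majD P P' Q Q' : maj P Q -> maj P' Q' -> maj (P + P') (Q + Q').
  by move=> PQ PQ' k; rewrite !coefD (le_trans (ler_normD _ _)) ?lerD.
have majM P P' Q Q' : maj P Q -> maj P' Q' -> maj (P * P') (Q * Q').
  move=> PQ PQ' k; rewrite !coefM (le_trans (ler_norm_sum _ _ _)) // ler_sum // => i _.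
  by rewrite normrM ler_pM.
have maj0 : maj 0 0 by move=> k; rewrite coef0.
have maj1 : maj 1 1 by move=> k; rewrite coef1; case: eqP.
have majP (i j : 'I_n) : maj (char_poly_mx M i j) ('X + m%:Z%:P).
  rewrite !mxE => k; rewrite coefB coefD coefMn !coefC coefX.
  apply: le_trans (ler_normB _ _) _; apply: lerD; first by case: eqP; case: eqP.
  by case: eqP => _ //; move: (Mm i j); rewrite -lez_nat abszE.
pose Q : {poly int} := \sum_(s : 'S_n) \prod_(i < n) ('X + m%:Z%:P).
have majQ : maj (char_poly M) Q.
  rewrite /char_poly /determinant /Q; apply: (big_ind2 maj maj0) => [*|s _ k]; first exact: majD.
  have : maj (\prod_(i < n) char_poly_mx M i (s i)) (\prod_(i < n) ('X + m%:Z%:P)).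
    by apply: (big_ind2 maj maj1) => [*|i _]; [exact: majM|exact: majP].
  by move=> /(_ k); rewrite mulr_sign; case: (odd_perm s); rewrite ?coefN ?normrN.
have Qk k : `|Q`_k| <= Q.[1].
  have [kQ|kQ] := ltnP k (size Q); last first.
    rewrite nth_default // normr0 horner_coef sumr_ge0 // => i _.
    by rewrite expr1n mulr1 (le_trans _ (majQ i)).
  rewrite horner_coef (bigD1 (Ordinal kQ)) //= expr1n mulr1.
  rewrite ger0_norm ?(le_trans _ (majQ k)) // lerDl sumr_ge0 // => i _.
  by rewrite expr1n mulr1 (le_trans _ (majQ i)).
have Q1 : Q.[1] = (n`! * m.+1 ^ n)%N.
  rewrite /Q horner_sum (eq_bigr (fun=> (m.+1%:Z) ^+ n)) => [|s _].
    rewrite sumr_const card_Sn; lia.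
  rewrite horner_prod (eq_bigr (fun=> m.+1%:Z)) => [|i _].
    by rewrite prodr_const card_ord.
  by rewrite hornerD hornerX hornerC intS.
have fact_le : (n`! <= n ^ n)%N.
  elim: n {M Mm majP Q majQ Qk Q1} => // n IHn; rewrite factS expnS leq_mul2l /=.
  by case: n IHn => // n IHn; apply: leq_trans IHn _; rewrite leq_exp2r.
move=> k; rewrite -lez_nat abszE; apply: le_trans (majQ k) _.
apply: le_trans (ler_norm _) _; apply: le_trans (Qk k) _.
by rewrite Q1 lez_nat leq_mul2r fact_le orbT.
Qed.

(** The characteristic polynomial is taken over the integers, where its coefficients have a size,
    and only then mapped to K. The exponent collects N^N (m + 1)^N from the determinant and c^k from
    the denominator. *)
Lemma height_le_intpoly n e x : height_le n e x ->
  exists Q : {poly int}, [/\ (size Q <= n.+1)%N,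
    forall k, (`|(Q`_k)%R| <= 2 ^ (n * (n + e.+1) + e * n))%N,
    map_poly intr Q != 0 :> {poly K} & root (map_poly intr Q) x].
Proof.
move=> [T [v [c [m [[[t0 vt0] c0] Tn ce me [A [Am Av]]]]]]].
pose N := #|T|; have {}Tn : (N <= n)%N := Tn.
pose M : 'M[int]_N := \matrix_(i, j) A (enum_val i) (enum_val j).
have szM : size (char_poly M) = N.+1 by rewrite size_char_poly.
have lcM : (char_poly M)`_N = 1.
  by have := monicP (char_poly_monic M); rewrite lead_coefE szM.
have rootM : root (map_poly intr (char_poly M) : {poly K}) (c%:R * x).
  rewrite map_char_poly -eigenvalue_root_char; apply/eigenvalueP.
  exists (\row_i v (enum_val i)).
    apply/rowP => j; rewrite !mxE -Av [RHS](reindex _ (onW_bij _ (enum_val_bij T))) /=.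
    by apply: eq_bigr => i _; rewrite !mxE.
  apply/eqP => /rowP/(_ (enum_rank t0)); rewrite !mxE enum_rankK => /eqP.
  by rewrite (negPf vt0).
pose H := (N ^ N * m.+1 ^ N)%N.
have HP k : (`|((char_poly M)`_k)%R| <= H)%N.
  by apply: coef_char_poly_bound => i j; rewrite mxE.
have HK : (H <= 2 ^ (n * (n + e.+1)))%N.
  rewrite /H -expnMn [(n * _)%N]mulnC expnM; apply: (@leq_trans ((2 ^ (n + e.+1)) ^ N)).
    case: (N) Tn => // N' Nn; rewrite leq_exp2r // expnD.
    apply: leq_mul; first exact: leq_trans Nn (ltnW (ltn_expl _ (ltnSn 1))).
    by rewrite expnS mul2n -addnn -addn1 leq_add // expn_gt0.
  by rewrite leq_exp2l // ?expn_gt0 // -[X in (X < _)%N](expn0 2) ltn_exp2l ?addnS.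
(* Substituting c X turns the root c x into x. The top coefficient becomes c ^ N, nonzero in K, so Q
   survives reduction. *)
pose Q : {poly int} := \poly_(k < N.+1) ((char_poly M)`_k * c%:Z ^+ k).
exists Q; split.
- exact: leq_trans (size_poly _ _) _.
- move=> k; rewrite coef_poly; case: ltnP => // kN.
  rewrite abszM abszX /= expnD leq_mul ?(leq_trans (HP k)) // expnM.
  apply: (@leq_trans ((2 ^ e) ^ k)); first by case: (k) => // k'; rewrite leq_exp2r.
  by rewrite leq_pexp2l ?expn_gt0 // (leq_trans _ Tn).
- apply/eqP => /(congr1 (fun P : {poly K} => P`_N)); rewrite coef_map coef0 coef_poly ltnSn lcM mul1r.
  by rewrite /= rmorphXn /= -pmulrn => /eqP; rewrite expf_eq0 (negPf c0) andbF.
have := rootP rootM; rewrite horner_coef size_map_poly_id0; last first.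
  by rewrite lead_coefE szM lcM rmorph1 oner_neq0.
rewrite szM => sum0; rewrite rootE /Q map_polyE; apply/eqP.
rewrite -[RHS]sum0 (horner_coef_wide _ (n := N.+1)); last first.
  by rewrite -map_polyE (leq_trans (size_poly _ _)) // size_poly.
apply: eq_bigr => i _; rewrite -map_polyE !coef_map /= coef_poly ltn_ord.
by rewrite rmorphM rmorphXn /= -pmulrn exprMn mulrA.
Qed.

(** The reversed integer polynomial of x has the root 1/x and the same coefficient bound. *)
Lemma height_leV n e x : height_le n e x ->
  height_le n (n * (n + e.+1) + e * n) x^-1.
Proof.
have [->|x0] := eqVneq x 0.
  rewrite invr0 => hn; apply: height_le_leq (hn) => //.
  case: n hn => [[T [v [c [m [[[t _] _] T0 _ _ _]]]]]|n _]; last by rewrite mulSn; lia.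
  by move: T0; rewrite leqNgt; case/negP; apply/card_gt0P; exists t.
move=> /height_le_intpoly[Q [szQ Qk Q0 Qx]].
(* Reversal at n instead of the actual degree only adds factors X, which are harmless. *)
pose Q' : {poly K} := \poly_(i < n.+1) (Q`_(n - i))%:~R.
have Q'0 : Q' != 0.
  apply: contra Q0 => /eqP Q'0; apply/eqP/polyP => k; rewrite coef_map coef0.
  have [kn|nk] := leqP k n; last by rewrite nth_default ?rmorph0 // (leq_trans szQ).
  have := congr1 (fun P : {poly K} => P`_(n - k)) Q'0.
  by rewrite coef_poly coef0 ltnS leq_subr subKn.
have Q'x : root Q' x^-1.
  have xE k : (k <= n)%N -> x^-1 ^+ (n - k) = x ^+ k * x^-1 ^+ n.
    move=> kn; rewrite -[in RHS](subnK kn) addnC exprD mulrA -exprMn mulfV //.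
    by rewrite expr1n mul1r.
  rewrite rootE horner_poly (reindex_inj rev_ord_inj) /=.
  have := rootP Qx; rewrite (horner_coef_wide _ (n := n.+1)); last first.
    by rewrite (leq_trans (size_poly _ _)).
  move=> /(congr1 (fun y => y * x^-1 ^+ n)); rewrite mul0r mulr_suml => sum0.
  apply/eqP; rewrite -[RHS]sum0; apply: eq_bigr => i _.
  have ni : (i <= n)%N by rewrite -ltnS.
  by rewrite coef_map /= subSS subKn // xE // mulrA.
have sQ : ((size Q').-1 <= n)%N.
  by have : (size Q' <= n.+1)%N := size_poly _ _; case: (size Q').
apply: (height_le_leq sQ (leqnn _)); apply: height_le_poly => // k.
rewrite coef_poly; case: ifP => _; last by exists 0.
by exists Q`_(n - k).
Qed.

End Height.

(** * Finite prime fields: failure of the two kinds of axioms, and the cost of an element *)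

Section FiniteFields.
Local Open Scope ring_scope.

(* x |-> x^2 on one of each pair {x, -x} and x |-> -x^2 on the other one is injective. *)
Lemma square_or_opp_square (K : finFieldType) : (forall z : K, z ^+ 2 != -1) ->
  forall a : K, exists z, z ^+ 2 = a \/ z ^+ 2 = - a.
Proof.
move=> nosq a.
have sqN (x y : K) : x ^+ 2 = - y ^+ 2 -> y = 0.
  move=> xy; apply: contrapT => /eqP y0; case/eqP: (nosq (x / y)).
  by rewrite expr_div_n xy mulNr divff ?expf_neq0.
pose half (x : K) := (enum_rank x <= enum_rank (- x))%N.
have halfN (x y : K) : half x = half y -> x = - y -> x = y.
  move=> + xy; rewrite xy /half opprK; have [yy|yy|yy _] := ltngtP (enum_rank (- y)) (enum_rank y) => //.
  by apply: enum_rank_inj; apply: val_inj.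
pose f (x : K) := if half x then x ^+ 2 else - x ^+ 2.
have f_inj : injective f.
  move=> x y; rewrite /f; case: ifP => hx; case: ifP => hy.
  - move/eqP; rewrite eqf_sqr => /orP[/eqP//|/eqP xy].
    by apply: halfN => //; rewrite hx hy.
  - move=> xy; have y0 := sqN _ _ xy.
    by move: xy; rewrite y0 expr0n oppr0 => /eqP; rewrite sqrf_eq0 => /eqP.
  - move=> xy; have x0 := sqN _ _ (esym xy).
    by move: xy; rewrite x0 expr0n oppr0 => /esym/eqP; rewrite sqrf_eq0 => /eqP->.
  - move/oppr_inj/eqP; rewrite eqf_sqr => /orP[/eqP//|/eqP xy].
    by apply: halfN => //; rewrite hx hy.
have := f_invF f_inj a; move: (invF f_inj a) => z; rewrite /f.
by case: ifP => _ <-; exists z; [left|right; rewrite opprK].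
Qed.

(** Otherwise, adding 1 repeatedly, every numeral would be a square, and -1 is a numeral in a prime
    field. *)
Lemma sum_squares_nonsquare (q : nat) : (forall z : 'F_q, z ^+ 2 != -1) ->
  exists x y : 'F_q, forall z, x ^+ 2 + y ^+ 2 != z ^+ 2.
Proof.
move=> nosq; apply: contrapT => /forallNP sq.
have {}sq (x y : 'F_q) : exists z, x ^+ 2 + y ^+ 2 = z ^+ 2.
  have /forallNP/(_ y)/existsNP[z /negP] := sq x.
  by rewrite negbK => /eqP; exists z.
have sqn n : exists z : 'F_q, n%:R = z ^+ 2.
  elim: n => [|n [z nz]]; first by exists 0; rewrite expr0n.
  by have [w zw] := sq z 1; exists w; rewrite -zw -nz expr1n natr1.
have [z zE] := sqn (nat_of_ord (-1 : 'F_q)).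
by case/eqP: (nosq z); rewrite -zE natr_Zp.
Qed.

(** x^d - x takes the same value at 0 and 1; on a finite set a map that is not injective is not
    surjective. *)
Lemma odd_poly_no_root (K : finFieldType) (d : nat) : odd d -> (1 < d)%N ->
  exists c : K, forall x, x ^+ d - x != c.
Proof.
move=> oddd d1; apply: contrapT => noc.
pose f (x : K) := x ^+ d - x.
have fS c : exists x, f x == c.
  apply: contrapT => H; apply: noc; exists c => x.
  by apply/negP => fx; apply: H; exists x.
pose g c := xchoose (fS c).
have gK : cancel g f by move=> c; exact/eqP/(xchooseP (fS c)).
have [h _ hK] : bijective g by apply: injF_bij; exact: can_inj gK.
have f_inj : injective f.
  by move=> x y fxy; rewrite -(hK x) -(hK y) !gK in fxy; rewrite -(hK x) fxy hK.
have d0 : (d == 0)%N = false by case: d d1 {f fS g gK h hK f_inj oddd noc}.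
have : f 0 = f 1 by rewrite /f expr0n d0 expr1n !subrr.
by move/f_inj/esym/eqP; rewrite oner_eq0.
Qed.

Variable q : nat.
Hypothesis qp : prime q.

Lemma Fp_nat_eq0 k : (k%:R == 0 :> 'F_q) = (k %% q == 0)%N.
Proof. by rewrite -(dvdn_pcharf (pchar_Fp qp)) /dvdn. Qed.

Lemma ltn_Fp (a : 'F_q) : (a < q)%N.
Proof. by rewrite -[X in (_ < X)%N](Fp_cast qp) ltn_ord. Qed.

Lemma Fp_intP (a : 'F_q) : exists z : int, z%:~R = a /\ `|z|%N = Fabs a.
Proof.
have aq := ltn_Fp a.
have [le|lt] := leqP a (q - a).
  exists (a : nat)%:Z; split; first by rewrite -pmulrn natr_Zp.
  by rewrite /Fabs (minn_idPl le).
exists ((a : nat)%:Z - q%:Z); split; last by rewrite /Fabs (minn_idPr (ltnW lt)); lia.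
by rewrite rmorphB /= -!pmulrn natr_Zp (pcharf0 (pchar_Fp qp)) subr0.
Qed.

Lemma Fabs_int (z : int) : (Fabs (z%:~R : 'F_q) <= `|z|)%N.
Proof.
have natF k : (k%:R : 'F_q) = (k %% q)%N :> nat := val_Fp_nat qp k.
case: (intP z) => [|k|k]; rewrite ?abszN.
- by rewrite /Fabs geq_min.
- by rewrite /Fabs -pmulrn natF geq_min leq_mod.
rewrite rmorphN /= -pmulrn; set a : 'F_q := k.+1%:R.
have aE : a = (k.+1 %% q)%N :> nat := natF _.
have opp_val r : (Zp_trunc (pdiv q)).+2 = r -> (- a : 'F_q) = ((r - a) %% r)%N :> nat.
  by move=> <-.
rewrite /Fabs (opp_val q (Fp_cast qp)) geq_min; have := ltn_Fp a; case: (posnP a) => [a0 _|a0 aq].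
  by rewrite a0 subn0 modnn.
rewrite modn_small ?subKn ?(ltnW aq) ?aE ?leq_mod ?orbT //.
by rewrite -aE ltn_subrL a0 prime_gt0.
Qed.

(** One coordinate of the set minimised by [fQbar], on natural representatives so that it applies to
    [repr] directly. *)
Definition cost_attained (x h : nat) : Prop := exists n m k,
  [/\ (1 <= n)%N, (k %% q)%N <> 0%N, h = (n + up_log 2 (maxn m k))%N &
    exists2 M : 'M['F_q]_n, (forall r s, (Fabs (M r s) <= m)%N) &
      eigenvalue M (k * x %% q)%:R].

(** With [height_cost] this makes cost and height interchangeable up to a factor 2, invisible to a
    cut closed under addition. *)
Lemma cost_height x h : cost_attained x h -> height_le h h (x%:R : 'F_q).
Proof.
move=> [n [m [k [n1 /eqP k0 -> [M Mm /eigenvalueP[v vM v0]]]]]].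
have [A AP] := choice (fun rs : 'I_n * 'I_n => Fp_intP (M rs.1 rs.2)).
have [j vj] : exists j, v 0 j != 0.
  by apply: contrapT => /forallNP v0'; case/eqP: v0; apply/rowP => j; rewrite mxE;
     have /negP := v0' j; rewrite negbK => /eqP.
have up_le l : (l <= maxn m k -> l <= 2 ^ (n + up_log 2 (maxn m k)))%N.
  move=> lm; apply: leq_trans lm (leq_trans (up_logP _ (ltnSn 1)) _).
  by rewrite leq_exp2l // leq_addl.
exists 'I_n, (v 0), k, m; split.
- by split; [exists j|rewrite Fp_nat_eq0].
- by rewrite card_ord leq_addr.
- by rewrite up_le // leq_maxr.
- by rewrite up_le // leq_maxl.
exists (fun r s => A (r, s)); split=> [r s|t]; first by rewrite (AP (r, s)).2.
move/rowP/(_ t): vM; rewrite !mxE (Fp_nat_mod qp) natrM => <-.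
by apply: eq_bigr => s _; rewrite (AP (s, t)).1.
Qed.

Lemma height_cost n e x : height_le n e (x%:R : 'F_q) ->
  exists2 h, cost_attained x h & (h <= n + e)%N.
Proof.
move=> [T [v [c [m [[[t0 vt0] c0] Tn ce me [A [Am Av]]]]]]].
have T0 : (0 < #|T|)%N by apply/card_gt0P; exists t0.
exists (#|T| + up_log 2 (maxn m c))%N.
  exists #|T|, m, c; split=> //; first by apply/eqP; rewrite -Fp_nat_eq0.
  exists (\matrix_(i, j) (A (enum_val i) (enum_val j))%:~R).
    by move=> r s; rewrite mxE; apply: leq_trans (Fabs_int _) (Am _ _).
  apply/eigenvalueP; exists (\row_i v (enum_val i)).
    apply/rowP => j; rewrite !mxE (Fp_nat_mod qp) natrM -Av.
    rewrite [RHS](reindex _ (onW_bij _ (enum_val_bij T))) /=.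
    by apply: eq_bigr => i _; rewrite !mxE.
  apply/eqP => /rowP/(_ (enum_rank t0)); rewrite !mxE enum_rankK => /eqP.
  by rewrite (negPf vt0).
by rewrite leq_add // up_log_min // geq_max me.
Qed.

(** The 1 x 1 matrix with entry x already attains this cost, so minima exist and no element costs
    more. *)
Lemma cost_attained_le x : exists2 h, cost_attained x h & (h <= 1 + up_log 2 q)%N.
Proof.
apply: height_cost; exists unit, (fun=> 1), 1%N, q; rewrite card_unit; split.
- by split; [exists tt|]; rewrite oner_eq0.
- by [].
- by rewrite expn_gt0.
- exact: up_logP.
have [z [zx zq]] := Fp_intP x%:R.
exists (fun _ _ => z); split=> [_ _|_]; first by rewrite zq geq_min ltnW ?ltn_Fp.
by rewrite big_const card_unit /= addr0 mul1r mulr1 zx mul1r.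
Qed.

End FiniteFields.

(** * Transfer, internal extrema and saturation in the ultrapower *)

Section Ultraproducts.
Local Open Scope classical_set_scope.
Local Open Scope quotient_scope.
Local Open Scope order_scope.
Context (I : Type) (F : set_system I) (FU : UltraFilter F).
Local Notation HN := (hypernat FU).
Local Notation cls u := (\pi_HN u).

#[local] Instance FF : ProperFilter F := ultra_proper.

Lemma ultraN (A : set I) : ~ F A <-> F (~` A).
Proof.
split=> [nA|FnA FA]; first by have [] := in_ultra_setVsetC A FU.
by have [i [nAi Ai]] := filter_ex (filterI FnA FA).
Qed.

Lemma ultra_ex (T : Type) (t0 : T) (P : I -> T -> Prop) :
  F [set i | exists t, P i t] -> exists u : I -> T, F [set i | P i (u i)].
Proof.
move=> FP; have /choice[u uP] : forall i, exists t, (exists t', P i t') -> P i t.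
  by move=> i; have [[t Pt]|nP] := pselect (exists t, P i t); [exists t|exists t0].
by exists u; apply: filterS FP => i; apply: uP.
Qed.

Lemma ultra_fin (T : finType) (P : I -> T -> Prop) :
  F [set i | exists t, P i t] -> exists t, F [set i | P i t].
Proof.
move=> FP; apply: contrapT => /forallNP nP.
have Fn : F [set i | forall t, t \in enum T -> ~ P i t].
  by apply: (@filter_all_seq _ _ F _ (enum T) (fun t i => ~ P i t)) => t _; apply/ultraN/nP.
have [i [/= [t Pt] nPi]] := filter_ex (filterI FP Fn).
by apply: (nPi t); rewrite ?mem_enum.
Qed.

Lemma hyper_eq (x y : HN) : x = y <-> F [set i | repr x i = repr y i].
Proof. by rewrite -pi_ultra_eq !reprK. Qed.

Lemma hyper_le (x y : HN) : x <= y <-> F [set i | (repr x i <= repr y i)%N].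
Proof. by rewrite -(hle_pi FU) !reprK. Qed.

Lemma hyper_lt (x y : HN) : x < y <-> F [set i | (repr x i < repr y i)%N].
Proof.
rewrite ltNge; split=> [/negP|xy].
  move=> /(contra_not (hyper_le y x).2)/ultraN; apply: filterS => i /negP.
  by rewrite -ltnNge.
apply/negP => /hyper_le yx; have [i [/= xyi]] := filter_ex (filterI xy yx).
by rewrite leqNgt xyi.
Qed.

Lemma repr_add (x y : HN) : F [set i | repr (x + y)%R i = (repr x i + repr y i)%N].
Proof. exact: repr_ultra. Qed.

Lemma repr_mul (x y : HN) : F [set i | repr (x * y)%R i = (repr x i * repr y i)%N].
Proof. exact: repr_ultra. Qed.

Lemma repr_hmod (x y : HN) : F [set i | repr (hmod x y) i = (repr x i %% repr y i)%N].
Proof. exact: repr_ultra. Qed.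

Lemma repr_hsub (x y : HN) : F [set i | repr (hsub x y) i = (repr x i - repr y i)%N].
Proof. exact: repr_ultra. Qed.

Lemma repr_hconst n : F [set i | repr (hconst FU n) i = n].
Proof. exact: repr_ultra. Qed.

Lemma repr_hexp (x : HN) n : F [set i | repr (x ^+ n)%R i = (repr x i ^ n)%N].
Proof.
elim: n => [|n IHn]; first exact: repr_hconst.
rewrite exprS; apply: filterS2 (repr_mul x (x ^+ n)%R) IHn => i /= -> ->.
by rewrite expnS.
Qed.

Lemma is_least_unique (S : set HN) x y : is_least S x -> is_least S y -> x = y.
Proof. by move=> [Sx lx] [Sy ly]; apply/le_anti; rewrite lx ?ly. Qed.

Lemma is_greatest_unique (S : set HN) x y : is_greatest S x -> is_greatest S y -> x = y.
Proof. by move=> [Sx lx] [Sy ly]; apply/le_anti; rewrite lx ?ly. Qed.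

Lemma hmin_least (S : set HN) x : is_least S x -> hmin S = x.
Proof.
by move=> Sx; apply: xget_unique => // y Sy; apply: is_least_unique Sy Sx.
Qed.

Lemma hmax_greatest (S : set HN) x : is_greatest S x -> hmax S = x.
Proof.
by move=> Sx; apply: xget_unique => // y Sy; apply: is_greatest_unique Sy Sx.
Qed.

Lemma internal_least (S : set HN) (P : I -> nat -> Prop) :
    (forall x, S x <-> F [set i | P i (repr x i)]) -> F [set i | exists n, P i n] ->
  exists2 u : I -> nat, is_least S (cls u) &
    F [set i | P i (u i) /\ forall n, P i n -> (u i <= n)%N].
Proof.
move=> SP exP.
have [|u uP] := @ultra_ex nat 0%N (fun i m => P i m /\ forall n, P i n -> (m <= n)%N).
  apply: filterS exP => i [n Pn].
  have exb : exists n, `[< P i n >] by exists n; apply/asboolP.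
  have [m /asboolP Pm mmin] := ex_minnP exb.
  by exists m; split=> // k /asboolP; apply: mmin.
exists u => //; split.
  by apply/SP; apply: filterS2 (repr_ultra FU u) uP => i /= -> [].
move=> y /SP Py; apply/hyper_le.
by apply: filterS3 (repr_ultra FU u) uP Py => i /= -> [_ H] Hy; apply: H.
Qed.

Lemma internal_greatest (S : set HN) (P : I -> nat -> Prop) :
    (forall x, S x <-> F [set i | P i (repr x i)]) ->
    F [set i | exists n, P i n] -> F [set i | exists m, forall n, P i n -> (n <= m)%N] ->
  exists x, is_greatest S x.
Proof.
move=> SP exP bndP.
have [|u uP] := @ultra_ex nat 0%N (fun i m => P i m /\ forall n, P i n -> (n <= m)%N).
  apply: filterS2 exP bndP => i [n Pn] [b nb].
  have exb : exists n, `[< P i n >] by exists n; apply/asboolP.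
  have bndb k : `[< P i k >] -> (k <= b)%N by move=> /asboolP/nb.
  have [m /asboolP Pm mmax] := ex_maxnP exb bndb.
  by exists m; split=> // k /asboolP; apply: mmax.
exists (cls u); split.
  by apply/SP; apply: filterS2 (repr_ultra FU u) uP => i /= -> [].
move=> y /SP Py; apply/hyper_le.
by apply: filterS3 (repr_ultra FU u) uP Py => i /= -> [_ H] Hy; apply: H.
Qed.

(** Coordinate i satisfies as many of the conditions as it can: those up to the last m with i in D
    m. *)
Lemma internal_saturation (Finc : countably_incomplete F) (T : Type) (t0 : T)
    (B : nat -> I -> T -> Prop) :
  (forall n, F [set i | exists t, forall k, (k <= n)%N -> B k i t]) ->
  exists u : I -> T, forall n, F [set i | B n i (u i)].
Proof.
move=> FB; have [A [FA nFA]] := Finc.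
(* Countable incompleteness makes the decreasing large sets D n have empty intersection, so each i
   in D 0 has a last index. *)
pose D n := [set i | (forall k, (k <= n)%N -> A k i) /\
  ~ (\bigcap_k A k) i /\ exists t, forall k, (k <= n)%N -> B k i t].
have FAn n : F [set i | forall k, (k <= n)%N -> A k i].
  apply: filterS (@filter_all_seq _ _ F _ (iota 0 n.+1) A (fun k _ => FA k)).
  by move=> i Ai k kn; apply: Ai; rewrite mem_iota ltnS.
have FD n : F (D n).
  by apply: filterS3 (FAn n) (FB n) ((ultraN _).1 nFA) => i /= *; split.
have DS n m : (n <= m)%N -> D m `<=` D n.
  move=> nm i [Ai [nA [t Bt]]]; split; first by move=> k kn; apply: Ai; apply: leq_trans nm.
  by split=> //; exists t => k kn; apply: Bt; apply: leq_trans nm.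
have last i : exists t, forall n, D n i -> B n i t.
  have [D0|nD0] := pselect (D 0%N i); last first.
    by exists t0 => n Dn; case: nD0; apply: DS Dn.
  have exb : exists n, `[< D n i >] by exists 0%N; apply/asboolP.
  have [l nAl] : exists l, ~ A l i.
    by apply: contrapT => /forallNP Ai; have [_ [+ _]] := D0; apply=> k _; apply: contrapT (Ai k).
  have bndb n : `[< D n i >] -> (n <= l)%N.
    by move=> /asboolP[Ai _]; rewrite leqNgt; apply/negP => ln; apply/nAl/Ai/ltnW.
  have [m /asboolP[_ [_ [t Bt]]] mmax] := ex_maxnP exb bndb.
  by exists t => n /asboolP/mmax; apply: Bt.
have [u uP] := choice last.
by exists u => n; apply: filterS (FD n) => i /uP.
Qed.

End Ultraproducts.

(** * The hyperfinite field as an ultraproduct of prime fields *)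

Section HyperField.
Local Open Scope classical_set_scope.
Local Open Scope quotient_scope.
Local Open Scope order_scope.
Local Open Scope ring_scope.
Context (I : Type) (F : set_system I) (FU : UltraFilter F).
Local Notation HN := (hypernat FU).
Local Notation cls u := (\pi_HN u).
Variables (p : HN) (pp : hprime p).

Definition residue (x : HN) (i : I) : 'F_(repr p i) := (repr x i)%:R.

Definition of_residues (a : forall i, 'F_(repr p i)) : HN := cls (fun i => a i : nat).

Lemma residue_of_residues a : F [set i | residue (of_residues a) i = a i].
Proof.
by apply: filterS (repr_ultra FU (fun i => a i : nat)) => i /= ai; rewrite /residue ai natr_Zp.
Qed.

Lemma of_residues_lt a : (of_residues a < p)%O.
Proof.
apply/hyper_lt; apply: filterS2 (repr_ultra FU (fun i => a i : nat)) pp => i /= -> pi.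
exact: ltn_Fp.
Qed.

Lemma residue_inj x y : (x < p)%O -> (y < p)%O ->
  F [set i | residue x i = residue y i] -> x = y.
Proof.
move=> /hyper_lt xp /hyper_lt yp xy; apply/hyper_eq.
apply: filterS3 pp xp (filterI yp xy) => i /= pi xi [yi /(congr1 (fun a : 'F_ _ => a : nat))].
by rewrite /residue !(val_Fp_nat pi) !modn_small.
Qed.

Lemma hmod_lt x : (hmod x p < p)%O.
Proof.
by apply/hyper_lt; apply: filterS2 (repr_hmod x p) pp => i /= -> pi; rewrite ltn_mod prime_gt0.
Qed.

Lemma residue_hmod x : F [set i | residue (hmod x p) i = residue x i].
Proof.
apply: filterS2 (repr_hmod x p) pp => i /= xi pi.
by rewrite /residue xi (Fp_nat_mod pi).
Qed.

Lemma residue_addp x y : F [set i | residue (addp p x y) i = residue x i + residue y i].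
Proof.
apply: filterS2 (residue_hmod (x + y)) (repr_add x y) => i /= -> xy.
by rewrite /residue xy natrD.
Qed.

Lemma residue_mulp x y : F [set i | residue (mulp p x y) i = residue x i * residue y i].
Proof.
apply: filterS2 (residue_hmod (x * y)) (repr_mul x y) => i /= -> xy.
by rewrite /residue xy natrM.
Qed.

Lemma residue_subp x y : (y < p)%O ->
  F [set i | residue (subp p x y) i = residue x i - residue y i].
Proof.
move=> /hyper_lt yp; apply: filterS2 (residue_hmod (x + hsub p y))
  (filterI (repr_add x (hsub p y)) (filterI (repr_hsub p y) (filterI yp pp))).
move=> i /= -> [xy [py [yi pi]]].
by rewrite /residue xy py natrD natrB ?(ltnW yi) // (pcharf0 (pchar_Fp pi)) sub0r.
Qed.

Lemma residue_hconst n : F [set i | residue (hconst FU n) i = n%:R].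
Proof. by apply: filterS (repr_hconst FU n) => i /= E; rewrite /residue E. Qed.

(* The argument pp only makes the field structure inferable. *)
Definition hfield (_ : hprime p) := {x : HN | (x < p)%O}.
Local Notation Fp := (hfield pp).

HB.instance Definition _ := Choice.on Fp.

Definition of_res (a : forall i, 'F_(repr p i)) : Fp := exist _ (of_residues a) (of_residues_lt a).
Local Notation res x := (residue (sval (x : Fp))).

Lemma res_of_res a : F [set i | res (of_res a) i = a i].
Proof. exact: residue_of_residues. Qed.

Lemma hfield_eq (x y : Fp) : F [set i | res x i = res y i] -> x = y.
Proof. by move=> xy; apply: val_inj; exact: residue_inj (valP x) (valP y) xy. Qed.

(** The operations are taken coordinatewise in the fields 'F_(p i), where the field laws are at
    hand; [val_hfieldD] and its companions identify them afterwards with arithmetic modulo p. *)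
Let zero := of_res (fun=> 0).
Let one := of_res (fun=> 1).
Let add (x y : Fp) := of_res (fun i => res x i + res y i).
Let opp (x : Fp) := of_res (fun i => - res x i).
Let mul (x y : Fp) := of_res (fun i => res x i * res y i).
Let inv (x : Fp) := of_res (fun i => (res x i)^-1).

Let addP x y : F [set i | res (add x y) i = res x i + res y i].
Proof. exact: res_of_res. Qed.
Let mulP x y : F [set i | res (mul x y) i = res x i * res y i].
Proof. exact: res_of_res. Qed.
Let oppP x : F [set i | res (opp x) i = - res x i].
Proof. exact: res_of_res. Qed.
Let invP x : F [set i | res (inv x) i = (res x i)^-1].
Proof. exact: res_of_res. Qed.
Let zeroP : F [set i | res zero i = 0].
Proof. exact: res_of_res. Qed.
Let oneP : F [set i | res one i = 1].
Proof. exact: res_of_res. Qed.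

Let addA : associative add.
Proof.
move=> x y z; apply: hfield_eq.
apply: filterS2 (filterI (addP x (add y z)) (addP y z)) (filterI (addP (add x y) z) (addP x y)).
by move=> i /= [-> ->] [-> ->]; rewrite addrA.
Qed.

Let addC : commutative add.
Proof.
move=> x y; apply: hfield_eq; apply: filterS2 (addP x y) (addP y x) => i /= -> ->.
exact: addrC.
Qed.

Let add0 : left_id zero add.
Proof.
move=> x; apply: hfield_eq; apply: filterS2 (addP zero x) zeroP => i /= -> ->.
exact: add0r.
Qed.

Let addN : left_inverse zero opp add.
Proof.
move=> x; apply: hfield_eq; apply: filterS3 (addP (opp x) x) (oppP x) zeroP => i /= -> -> ->.
exact: addNr.
Qed.

HB.instance Definition _ := GRing.isZmodule.Build Fp addA addC add0 addN.

Let mulA : associative mul.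
Proof.
move=> x y z; apply: hfield_eq.
apply: filterS2 (filterI (mulP x (mul y z)) (mulP y z)) (filterI (mulP (mul x y) z) (mulP x y)).
by move=> i /= [-> ->] [-> ->]; rewrite mulrA.
Qed.

Let mulC : commutative mul.
Proof.
move=> x y; apply: hfield_eq; apply: filterS2 (mulP x y) (mulP y x) => i /= -> ->.
exact: mulrC.
Qed.

Let mul1 : left_id one mul.
Proof.
move=> x; apply: hfield_eq; apply: filterS2 (mulP one x) oneP => i /= -> ->.
exact: mul1r.
Qed.

Let mulD : left_distributive mul add.
Proof.
move=> x y z; apply: hfield_eq.
apply: filterS3 (filterI (mulP (add x y) z) (addP x y)) (addP (mul x z) (mul y z))
  (filterI (mulP x z) (mulP y z)).
by move=> i /= [-> ->] -> [-> ->]; rewrite mulrDl.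
Qed.

Let one_neq0 : one != zero.
Proof.
apply/eqP => E; have E1 : F [set i | res zero i = 1] by rewrite -E; exact: oneP.
have [i [/= -> /eqP]] := filter_ex (filterI zeroP E1).
by rewrite eq_sym oner_eq0.
Qed.

HB.instance Definition _ :=
  GRing.Zmodule_isComNzRing.Build Fp mulA mulC mul1 mulD one_neq0.

Let mulV x : x != 0 -> inv x * x = 1.
Proof.
move=> x0; apply: hfield_eq.
have nz : F [set i | res x i != 0].
  have nx0 : ~ F [set i | res x i = 0].
    by move=> xz; case/eqP: x0; apply: hfield_eq; apply: filterS2 xz zeroP => i /= -> ->.
  by apply: filterS ((ultraN FU _).1 nx0) => i /= /eqP.
apply: filterS3 (mulP (inv x) x) (invP x) (filterI nz oneP) => i /= -> -> [nzi ->].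
exact: mulVf.
Qed.

Let inv0 : inv 0 = 0.
Proof.
by apply: hfield_eq; apply: filterS2 (invP zero) zeroP => i /= -> ->; rewrite invr0.
Qed.

HB.instance Definition _ := GRing.ComNzRing_isField.Build Fp mulV inv0.

Lemma res0 : F [set i | res 0 i = 0]. Proof. exact: zeroP. Qed.
Lemma res1 : F [set i | res 1 i = 1]. Proof. exact: oneP. Qed.
Lemma resD x y : F [set i | res (x + y) i = res x i + res y i].
Proof. exact: addP. Qed.
Lemma resN x : F [set i | res (- x) i = - res x i].
Proof. exact: oppP. Qed.
Lemma resM x y : F [set i | res (x * y) i = res x i * res y i].
Proof. exact: mulP. Qed.
Lemma resV x : F [set i | res (x^-1) i = (res x i)^-1].
Proof. exact: invP. Qed.

Lemma resX x n : F [set i | res (x ^+ n) i = res x i ^+ n].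
Proof.
elim: n => [|n IHn]; first exact: res1.
by apply: filterS2 (resM x (x ^+ n)) IHn => i /= xi E; rewrite exprS xi E -exprS.
Qed.

Lemma resMn x n : F [set i | res (x *+ n) i = res x i *+ n].
Proof.
elim: n => [|n IHn]; first exact: res0.
by apply: filterS2 (resD x (x *+ n)) IHn => i /= xi E; rewrite mulrS xi E -mulrS.
Qed.

Lemma res_int (z : int) : F [set i | res z%:~R i = z%:~R].
Proof.
have resn n : F [set i | res n%:R i = n%:R].
  by apply: filterS2 (resMn 1 n) res1 => i /= -> ->.
case: (intP z) => [|k|k]; [exact: res0|exact: resn|].
apply: filterS2 (resN k.+1%:R) (resn k.+1) => i /=.
by rewrite !rmorphN /= -!pmulrn => -> ->.
Qed.

Lemma res_sum (J : Type) (s : seq J) (f : J -> Fp) :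
  F [set i | res (\sum_(j <- s) f j) i = \sum_(j <- s) res (f j) i].
Proof.
elim: s => [|j s IHs].
  by apply: filterS res0 => i /= E; rewrite !big_nil.
by apply: filterS2 (resD (f j) (\sum_(j <- s) f j)) IHs => i /= xi E; rewrite !big_cons xi E.
Qed.

Lemma res_monic_poly d (a : 'I_d -> Fp) (x : Fp) :
  F [set i | res (x ^+ d + \sum_j a j * x ^+ j) i =
    res x i ^+ d + \sum_j res (a j) i * res x i ^+ j].
Proof.
apply: filterS3 (filterI (resD (x ^+ d) (\sum_j a j * x ^+ j)) (resX x d))
  (res_sum (index_enum 'I_d) (fun j => a j * x ^+ j))
  (@filter_all_seq _ _ F _ (enum 'I_d)
    (fun j i => res (a j * x ^+ j) i = res (a j) i * res x i ^+ j) _).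
  move=> i /= [-> ->] -> jE; congr (_ + _); apply: eq_bigr => j _.
  by apply: jE; rewrite mem_enum.
by move=> j _; apply: filterS2 (resM (a j) (x ^+ j)) (resX x j) => i /= -> ->.
Qed.

Lemma res_eq (x y : Fp) : x = y <-> F [set i | res x i = res y i].
Proof. by split=> [->|/hfield_eq//]; apply: filterE. Qed.

Lemma hfield_lt (x : Fp) : (sval x < p)%O.
Proof. exact: (valP x). Qed.

Lemma val_hfieldD (x y : Fp) : sval (x + y) = addp p (sval x) (sval y).
Proof.
apply: residue_inj; [exact: hfield_lt|exact: hmod_lt|].
by apply: filterS2 (resD x y) (residue_addp (sval x) (sval y)) => i /= -> ->.
Qed.

Lemma val_hfieldM (x y : Fp) : sval (x * y) = mulp p (sval x) (sval y).
Proof.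
apply: residue_inj; [exact: hfield_lt|exact: hmod_lt|].
by apply: filterS2 (resM x y) (residue_mulp (sval x) (sval y)) => i /= -> ->.
Qed.

Lemma val_hfieldB (x y : Fp) : sval (x - y) = subp p (sval x) (sval y).
Proof.
apply: residue_inj; [exact: hfield_lt|exact: hmod_lt|].
apply: filterS3 (resD x (- y)) (resN y) (residue_subp (sval x) (hfield_lt y)) => i /=.
by move=> -> -> ->.
Qed.

Lemma val_hfield0 : sval (0 : Fp) = 0.
Proof.
apply: residue_inj; first exact: hfield_lt.
  by apply/hyper_lt; apply: filterS2 (repr_hconst FU 0) pp => i /= -> /prime_gt0.
by apply: filterS2 res0 (residue_hconst 0) => i /= -> ->.
Qed.

Lemma val_hfield1 : sval (1 : Fp) = 1.
Proof.
apply: residue_inj; first exact: hfield_lt.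
  by apply/hyper_lt; apply: filterS2 (repr_hconst FU 1) pp => i /= -> /prime_gt1.
by apply: filterS2 res1 (residue_hconst 1) => i /= -> ->.
Qed.

Lemma val_hfieldX (x : Fp) n : sval (x ^+ n) = expp p (sval x) n.
Proof.
elim: n => [|n IHn]; first exact: val_hfield1.
by rewrite exprS val_hfieldM IHn.
Qed.

Lemma val_hfield_sum (J : Type) (s : seq J) (f : J -> Fp) :
  sval (\sum_(j <- s) f j) = \big[addp p/0]_(j <- s) sval (f j).
Proof. by elim: s => [|j s IHs]; rewrite ?big_nil ?val_hfield0 // !big_cons val_hfieldD IHs. Qed.

End HyperField.

(** * Transfer of the height to coordinates *)

Section InternalHeight.
Local Open Scope classical_set_scope.
Local Open Scope quotient_scope.
Local Open Scope order_scope.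
Context (I : Type) (F : set_system I) (FU : UltraFilter F).
Local Notation HN := (hypernat FU).
Local Notation cls u := (\pi_HN u).
Variables (p : HN) (pp : hprime p).

Lemma repr_max (x y : HN) : F [set i | repr (Order.max x y) i = maxn (repr x i) (repr y i)].
Proof.
have [xy|yx] := leP x y.
  by apply: filterS ((hyper_le x y).1 xy) => i /= /maxn_idPr->.
by apply: filterS ((hyper_lt y x).1 yx) => i /= /ltnW/maxn_idPl->.
Qed.

(** Los's theorem for the set minimised by [fQbar]; the work lies in gluing coordinate matrices into
    an internal one. *)
Lemma fQbar_attained (x h : HN) :
  (exists n m k : HN, [/\ (1%R : HN) <= n, hmod k p <> 0%R,
        h = (n + hceil_log2 (Order.max m k))%R
      & exists2 M : internal_matrix p n,
          entries_bounded_by m M & internal_eigenvalue M (mulp p k x)]) <->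
  F [set i | cost_attained (repr p i) (repr x i) (repr h i)].
Proof.
split=> [[n [m [k [/hyper_le n1 k0 -> [M Mm Mx]]]]]|].
  have {}k0 : F [set i | (repr k i %% repr p i)%N <> 0%N].
    have /(ultraN FU) : ~ F [set i | (repr k i %% repr p i)%N = 0%N].
      move=> kp; apply/k0/hyper_eq.
      by apply: filterS3 (repr_hmod k p) (repr_hconst FU 0) kp => i /= -> -> ->.
    by apply: filterS.
  have hE : F [set i | repr (n + hceil_log2 (Order.max m k))%R i =
     (repr n i + up_log 2 (maxn (repr m i) (repr k i)))%N].
    apply: filterS3 (repr_add n (hceil_log2 (Order.max m k)))
      (repr_ultra FU (fun i => up_log 2 (repr (Order.max m k) i))) (repr_max m k).
    by move=> i /= -> -> ->.
  have kxE : F [set i | repr (mulp p k x) i = ((repr k i * repr x i) %% repr p i)%N].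
    by apply: filterS2 (repr_hmod (k * x)%R p) (repr_mul k x) => i /= -> ->.
  rewrite /entries_bounded_by in Mm; rewrite /internal_eigenvalue in Mx.
  apply: filterS3 (filterI (filterI n1 (repr_hconst FU 1)) k0) (filterI hE kxE) (filterI Mm Mx).
  move=> i /= [[n1i c1] k0i] [-> kxi] [Mmi Mxi].
  exists (repr n i), (repr m i), (repr k i); split=> //; first by rewrite -c1.
  exists (M i); first exact: Mmi.
  rewrite -kxi; exact: Mxi.
move=> nmk; have {nmk}[n nmk] := ultra_ex FU 0%N nmk.
have {nmk}[m nmk] := ultra_ex FU 0%N nmk.
have {nmk}[k nmk] := ultra_ex FU 0%N nmk.
(* The size must be the chosen representative of the class of n, which agrees with n i only almost
   everywhere; hence a matrix is chosen wherever one of that size works, and an arbitrary one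
   elsewhere. *)
pose Q i (M : 'M['F_(repr p i)]_(repr (cls n) i)) :=
  (forall r s, (Fabs (M r s) <= m i)%N) /\ eigenvalue M ((k i * repr x i) %% repr p i)%:R%R.
have [M MQ] : exists M : internal_matrix p (cls n), forall i, (exists M', Q i M') -> Q i (M i).
  have MQ i : {M : 'M['F_(repr p i)]_(repr (cls n) i) | (exists M', Q i M') -> Q i M}.
    have [/cid[M' QM']|nM] := pselect (exists M', Q i M'); first by exists M'.
    by exists 0%R => /nM.
  by exists (fun i => sval (MQ i)) => i; apply: svalP (MQ i).
have FMQ : F [set i | Q i (M i)].
  apply: filterS2 nmk (repr_ultra FU n) => i /= [_ _ _ [M' M'm M'x]] ni; apply: MQ.
  (* Generalising the dimension allows the equality to be substituted inside the matrix type. *)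
  by rewrite /Q; move: (repr (cls n) i) ni => n' ->; exists M'.
exists (cls n), (cls m), (cls k); split.
- apply/hyper_le; apply: filterS3 nmk (repr_ultra FU n) (repr_hconst FU 1).
  by move=> i /= [n1 _ _ _] -> ->.
- move=> /hyper_eq k0.
  have [i [/= [_ kp _ _] [E0 [E1 [E2 E3]]]]] := filter_ex (filterI nmk
    (filterI k0 (filterI (repr_hmod (cls k) p) (filterI (repr_hconst FU 0) (repr_ultra FU k))))).
  by apply: kp; rewrite -E3 -E1 E0 E2.
- apply/hyper_eq.
  apply: filterS3 (filterI nmk (repr_add (cls n) (hceil_log2 (Order.max (cls m) (cls k)))))
     (filterI (repr_ultra FU (fun i => up_log 2 (repr (Order.max (cls m) (cls k)) i)))
        (repr_max (cls m) (cls k)))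
     (filterI (repr_ultra FU n) (filterI (repr_ultra FU m) (repr_ultra FU k))).
  by move=> i /= [[_ _ -> _] ->] [-> ->] [-> [-> ->]].
exists M.
  by apply: filterS2 FMQ (repr_ultra FU m) => i /= [Mm _] mi r s; rewrite mi.
apply: filterS2 FMQ (filterI (repr_hmod (cls k * x)%R p) (filterI (repr_mul (cls k) x) (repr_ultra FU k))).
by move=> i /= [_ Mx] [-> [-> ->]].
Qed.

Lemma fQbar_least (x : HN) : exists2 u : I -> nat, fQbar p x = cls u &
  F [set i | cost_attained (repr p i) (repr x i) (u i) /\
    forall h, cost_attained (repr p i) (repr x i) h -> (u i <= h)%N].
Proof.
have [|u uP uE] := @internal_least _ F FU _ (fun i => cost_attained (repr p i) (repr x i)) (fQbar_attained x).
  by apply: filterS pp => i /cost_attained_le-/(_ (repr x i))[h hP _]; exists h.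
by exists u => //; apply: hmin_least.
Qed.

Lemma fQbar_height (x : HN) :
  F [set i | height_le (repr (fQbar p x) i) (repr (fQbar p x) i) (residue p x i)].
Proof.
have [u -> uP] := fQbar_least x.
apply: filterS3 uP (repr_ultra FU u) pp => i /= [ux _] -> pi.
exact: cost_height pi _ _ ux.
Qed.

Lemma fQbar_le (x : HN) (n e : I -> nat) :
  F [set i | height_le (n i) (e i) (residue p x i)] ->
  fQbar p x <= cls (fun i => n i + e i)%N.
Proof.
move=> xne; have [u -> uP] := fQbar_least x; apply/hle_pi.
apply: filterS3 uP xne pp => i /= [_ umin] xi pi.
by have [h /umin uh hle] := height_cost pi xi; apply: leq_trans hle.
Qed.

Definition cheap (q n x : nat) : Prop := exists2 h, cost_attained q x h & (h < n)%N.

Lemma fQbar_lt (x n : HN) : fQbar p x < n <->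
  F [set i | cheap (repr p i) (repr n i) (repr x i)].
Proof.
have [u -> uP] := fQbar_least x; rewrite hyper_lt; split=> [un|].
  by apply: filterS3 uP un (repr_ultra FU u) => i /= [ux _] ui uE; exists (u i) => //; rewrite -uE.
move=> xn; apply: filterS3 uP xn (repr_ultra FU u) => i /= [_ umin] [h /umin uh hn] ->.
exact: leq_ltn_trans hn.
Qed.

Lemma nat_residue (x : HN) : x < p -> F [set i | residue p x i = repr x i :> nat].
Proof.
move=> /hyper_lt xp; apply: filterS2 xp pp => i /= xi pi.
by rewrite /residue (val_Fp_nat pi) modn_small.
Qed.

End InternalHeight.

(** * Internality of the conditions phi_d and their failure at p *)

Section Thresholds.
Local Open Scope classical_set_scope.
Local Open Scope quotient_scope.
Local Open Scope ring_scope.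
Context (I : Type) (F : set_system I) (FU : UltraFilter F).
Local Notation HN := (hypernat FU).
Local Notation cls u := (\pi_HN u).
Variables (p : HN) (pp : hprime p).
Local Notation Fp := (hfield pp).
Local Notation res x := (residue p (sval (x : Fp))).

Lemma ultra_dchoice (T : I -> Type) (t0 : forall i, T i) (P : forall i, T i -> Prop) :
  F [set i | exists t, P i t] -> exists u : forall i, T i, F [set i | P i (u i)].
Proof.
move=> FP; have uP i : {t : T i | (exists t', P i t') -> P i t}.
  by have [/cid[t Pt]|nP] := pselect (exists t, P i t); [exists t|exists (t0 i)].
by exists (fun i => sval (uP i)); apply: filterS FP => i; apply: (svalP (uP i)).
Qed.

Lemma phi_hfield d n : phi p d n <->
  if d == 2%N then
    forall x y : Fp, (fQbar p (sval x) < n)%O -> (fQbar p (sval y) < n)%O ->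
      exists z : Fp, x ^+ 2 + y ^+ 2 = z ^+ 2
  else
    forall a : 'I_d -> Fp, (forall i, (fQbar p (sval (a i)) < n)%O) ->
      exists x : Fp, x ^+ d + \sum_(i < d) a i * x ^+ i = 0.
Proof.
rewrite /phi; case: eqP => _.
  have sq (x y z : Fp) : x ^+ 2 + y ^+ 2 = z ^+ 2 <->
      addp p (mulp p (sval x) (sval x)) (mulp p (sval y) (sval y)) = mulp p (sval z) (sval z).
    rewrite !expr2 -!val_hfieldM -val_hfieldD; split=> [->//|H]; exact: val_inj.
  split=> H x y.
    move=> xn yn.
    have [z zp xyz] := H _ _ (conj (hfield_lt x) xn) (conj (hfield_lt y) yn).
    by exists (exist _ z zp : Fp); apply/sq.
  move=> [xp xn] [yp yn].
  have [z /sq xyz] := H (exist _ x xp) (exist _ y yp) xn yn.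
  by exists (sval z) => //; apply: hfield_lt.
have eqn (a : 'I_d -> Fp) (x : Fp) : x ^+ d + \sum_(i < d) a i * x ^+ i = 0 <->
    addp p (expp p (sval x) d) (\big[addp p/0]_(i < d) mulp p (sval (a i)) (expp p (sval x) i)) = 0.
  have -> : \big[addp p/0]_(i < d) mulp p (sval (a i)) (expp p (sval x) i) =
      sval (\sum_(i < d) a i * x ^+ i).
    by rewrite val_hfield_sum; apply: eq_bigr => i _; rewrite val_hfieldM val_hfieldX.
  rewrite -val_hfieldX -val_hfieldD -(val_hfield0 pp).
  by split=> [->//|H]; exact: val_inj.
split=> H a an.
  have [x xp xE] := H (fun i => sval (a i)) (fun i => conj (hfield_lt (a i)) (an i)).
  by exists (exist _ x xp : Fp); apply/eqn.
have [x /eqn xE] := H (fun i => exist _ (a i) (an i).1) (fun i => (an i).2).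
by exists (sval x) => //; apply: hfield_lt.
Qed.

Definition phi_at (d q n : nat) : Prop :=
  if d == 2%N then
    forall x y : 'F_q, cheap q n x -> cheap q n y -> exists z : 'F_q, x ^+ 2 + y ^+ 2 = z ^+ 2
  else
    forall a : 'I_d -> 'F_q, (forall i, cheap q n (a i)) ->
      exists x : 'F_q, x ^+ d + \sum_(i < d) a i * x ^+ i = 0.

Lemma fQbar_hfield_lt (x : Fp) (n : HN) : (fQbar p (sval x) < n)%O <->
  F [set i | cheap (repr p i) (repr n i) (res x i)].
Proof.
rewrite (fQbar_lt pp); have xE := nat_residue pp (hfield_lt x).
by split=> H; apply: filterS2 xE H => i /= ->.
Qed.

(** If [phi_at] failed almost everywhere, counterexamples chosen at the coordinates would glue to
    one in the hyperfinite field. This makes the set of n satisfying phi_d internal, so that it can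
    have a maximum. *)
Lemma phi_transfer d n : phi p d n <-> F [set i | phi_at d (repr p i) (repr n i)].
Proof.
rewrite phi_hfield /phi_at; case: eqP => _.
  split=> [H|Fn x y /fQbar_hfield_lt xn /fQbar_hfield_lt yn]; last first.
    have [|z zE] := @ultra_dchoice (fun i => 'F_(repr p i)) (fun i => 0)
        (fun i z => res x i ^+ 2 + res y i ^+ 2 = z ^+ 2).
      by apply: filterS3 Fn xn yn => i /= H; apply: H.
    exists (of_res pp z); apply: hfield_eq.
    apply: filterS3 (filterI (resD (x ^+ 2) (y ^+ 2)) zE)
      (filterI (resX x 2) (resX y 2)) (filterI (resX (of_res pp z) 2) (res_of_res pp z)).
    by move=> i /= [-> zi] [-> ->] [-> ->].
  apply: contrapT => nF0; have nF := (ultraN FU _).1 nF0.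
  have [|a aE] := @ultra_dchoice (fun i => ('F_(repr p i) * 'F_(repr p i))%type) (fun i => (0, 0))
     (fun i a => [/\ cheap (repr p i) (repr n i) a.1, cheap (repr p i) (repr n i) a.2 &
       ~ exists z, a.1 ^+ 2 + a.2 ^+ 2 = z ^+ 2]).
    apply: filterS nF => i /= /existsNP[x /existsNP[y /not_implyP[xn /not_implyP[yn nz]]]].
    exists (x, y); split; [exact: xn|exact: yn|exact: nz].
  pose x := of_res pp (fun i => (a i).1); pose y := of_res pp (fun i => (a i).2).
  have xE : F [set i | res x i = (a i).1] := res_of_res pp _.
  have yE : F [set i | res y i = (a i).2] := res_of_res pp _.
  have [||z zE] := H x y.
  - by apply/fQbar_hfield_lt; apply: filterS2 xE aE => i /= -> [].
  - by apply/fQbar_hfield_lt; apply: filterS2 yE aE => i /= -> [].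
  have [i [[_ _ nz] [xi [yi [xyi [Xi [Yi Zi]]]]]]] := filter_ex (filterI aE (filterI xE (filterI yE
    (filterI (resD (x ^+ 2) (y ^+ 2)) (filterI (resX x 2) (filterI (resX y 2) (resX z 2))))))).
  apply: nz; exists (res z i); rewrite -Zi -zE xyi.
  by rewrite Xi Yi xi yi.
split=> [H|Fn a an]; last first.
  have aE : F [set i | forall j, j \in enum 'I_d -> cheap (repr p i) (repr n i) (res (a j) i)].
    apply: (@filter_all_seq _ _ F _ (enum 'I_d) (fun j i => cheap (repr p i) (repr n i) (res (a j) i))).
    by move=> j _; apply/fQbar_hfield_lt.
  have [|x xE] := @ultra_dchoice (fun i => 'F_(repr p i)) (fun i => 0)
      (fun i x => x ^+ d + \sum_j res (a j) i * x ^+ j = 0).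
    by apply: filterS2 Fn aE => i /= H ai; apply: H => j; apply: ai; rewrite mem_enum.
  exists (of_res pp x); apply: hfield_eq.
  apply: filterS3 (res_monic_poly a (of_res pp x)) (filterI xE (res_of_res pp x)) (res0 pp).
  by move=> i /= -> [xi ->] ->.
apply: contrapT => nF0; have nF := (ultraN FU _).1 nF0.
have [|a aE] := @ultra_dchoice (fun i => 'I_d -> 'F_(repr p i)) (fun i => fun=> 0)
   (fun i a => (forall j, cheap (repr p i) (repr n i) (a j)) /\
     ~ exists x, x ^+ d + \sum_j a j * x ^+ j = 0).
  by apply: filterS nF => i /= /existsNP[a /not_implyP[an nx]]; exists a.
pose b j := of_res pp (fun i => a i j).
have bE j : F [set i | res (b j) i = a i j] := res_of_res pp _.
have [|x xE] := H b.
  by move=> j; apply/fQbar_hfield_lt; apply: filterS2 (bE j) aE => i /= -> [].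
have bE' : F [set i | forall j, j \in enum 'I_d -> res (b j) i = a i j].
  by apply: (@filter_all_seq _ _ F _ (enum 'I_d) (fun j i => res (b j) i = a i j)) => j _; exact: bE.
have [i [[_ nx] [bi [xi zi]]]] := filter_ex (filterI aE (filterI bE'
  (filterI (res_monic_poly b x) (res0 pp)))).
apply: nx; exists (res x i); rewrite -[RHS]zi -xE xi; congr (_ + _); apply: eq_bigr => j _.
by rewrite bi ?mem_enum.
Qed.

Lemma up_log_small q : (4 < q)%N -> (up_log 2 q <= q - 2)%N.
Proof.
move=> q4; apply: up_log_min => //; case: q q4 => [|[|[|[|k]]]] // _.
rewrite !subSS subn0; elim: k => // k IHk; rewrite expnS; lia.
Qed.

(** All costs are at most 1 + up_log 2 q < q, so for n >= q the condition would concern the whole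
    field, where it fails. *)
Lemma phi_at_lt d q n : prime q -> (4 < q)%N -> (forall z : 'F_q, z ^+ 2 != -1) ->
  degree_index d -> phi_at d q n -> (n < q)%N.
Proof.
move=> qp q4 nosq dI; rewrite /phi_at ltnNge => H; apply/negP => qn.
have allc (x : 'F_q) : cheap q n x.
  have [h hx hq] := cost_attained_le qp x; exists h => //; apply: leq_trans qn.
  apply: leq_ltn_trans hq _; rewrite add1n.
  by have := up_log_small q4; lia.
case: eqP H dI => [_ H _|d2 H [//|[oddd d1]]].
  have [x [y xy]] := sum_squares_nonsquare nosq.
  by have [z /eqP] := H x y (allc x) (allc y); apply/negP/xy.
have [c cE] := @odd_poly_no_root 'F_q d oddd d1.
(* The coefficients of x^d - x - c, with c a value that x^d - x omits. *)
pose a (i : 'I_d) : 'F_q := if i == 0%N :> nat then - c else if i == 1%N :> nat then - 1 else 0.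
have [x /eqP] := H a (fun i => allc (a i)).
apply/negP; suff -> : \sum_(i < d) a i * x ^+ i = - c - x.
  by rewrite addrC -addrA addrC addr_eq0 opprK addrC; apply: cE.
rewrite {}/a; case: d d1 {oddd d2 H cE} => [|[|d]] // _.
rewrite !big_ord_recl big1 ?addr0 /=; first by rewrite expr0 expr1 mulr1 mulN1r.
by move=> i _; rewrite mul0r.
Qed.

End Thresholds.

(** * Elements of standard height and nonstandardness of the thresholds *)

Section StandardPart.
Local Open Scope classical_set_scope.
Local Open Scope quotient_scope.
Local Open Scope ring_scope.
Context (I : Type) (F : set_system I) (FU : UltraFilter F).
Local Notation HN := (hypernat FU).
Local Notation cls u := (\pi_HN u).
Variables (p : HN) (pp : hprime p).
Hypothesis p_nonstd : nonstandard p.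
Hypothesis p_realalg : contains_real_algebraic_numbers p.
Hypothesis p_nosqrt : no_sqrt_of_minus_one p.
Local Notation Fp := (hfield pp).
Local Notation res x := (residue p (sval (x : Fp))).

Lemma nonstandard_gt n : F [set i | (n < repr p i)%N].
Proof.
apply: contrapT => np0; have np := (ultraN FU _).1 np0.
have [|t tE] := @ultra_fin _ F FU 'I_n.+1 (fun i t => repr p i = t).
  apply: filterS np => i /= /negP; rewrite -leqNgt => ip.
  by exists (Ordinal (ip : (repr p i < n.+1)%N)).
have /p_nonstd// : p = hconst FU t; apply/hyper_eq.
by apply: filterS2 tE (repr_hconst FU t) => i /= -> ->.
Qed.

Lemma hfield_nosq (z : Fp) : z ^+ 2 != -1.
Proof.
apply/eqP => zE; apply: p_nosqrt; exists (sval z); first exact: hfield_lt.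
by rewrite -val_hfieldM -expr2 zE -(val_hfield0 pp) -(val_hfield1 pp) -val_hfieldB sub0r.
Qed.

Lemma residue_nosq : F [set i | forall z : 'F_(repr p i), z ^+ 2 != -1].
Proof.
apply: contrapT => nF0; have nF := (ultraN FU _).1 nF0.
have [|z zE] := @ultra_dchoice _ F FU (fun i => 'F_(repr p i)) (fun i => 0)
   (fun i z => z ^+ 2 = -1).
  by apply: filterS nF => i /= /existsNP[z /negP]; rewrite negbK => /eqP; exists z.
case/eqP: (hfield_nosq (of_res pp z)); apply: hfield_eq.
apply: filterS3 (filterI (resX (of_res pp z) 2) (res_of_res pp z)) zE
  (filterI (resN (1 : Fp)) (res1 pp)).
by move=> i /= [-> ->] -> [-> ->].
Qed.

(** The alternative may vary with the coordinate; the ultrafilter decides which case holds almost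
    everywhere. *)
Lemma hfield_square (a : Fp) : exists z, z ^+ 2 = a \/ z ^+ 2 = - a.
Proof.
have [|z zE] := @ultra_dchoice _ F FU (fun i => 'F_(repr p i)) (fun i => 0)
   (fun i z => z ^+ 2 = res a i \/ z ^+ 2 = - res a i).
  by apply: filterS residue_nosq => i /square_or_opp_square/(_ (res a i)).
exists (of_res pp z).
have zX : F [set i | res (of_res pp z ^+ 2) i = z i ^+ 2].
  by apply: filterS2 (resX (of_res pp z) 2) (res_of_res pp z) => i /= -> ->.
have [za|nza] := in_ultra_setVsetC [set i | z i ^+ 2 = res a i] FU; [left|right]; apply: hfield_eq.
  by apply: filterS2 zX za => i /= ->.
apply: filterS3 zX (filterI nza zE) (resN a) => i /= -> [nzi [/nzi//|->]] ->.
by [].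
Qed.

Lemma realalg_morphism : inhabited {rmorphism realalg -> Fp}.
Proof.
have [g [gF g0 g1 gD gM]] := p_realalg.
pose h x : Fp := exist _ (g x) (gF x).
have h0 : h 0 = 0 by apply: val_inj; rewrite /= g0 -(val_hfield0 pp).
have h1 : h 1 = 1 by apply: val_inj; rewrite /= g1 -(val_hfield1 pp).
have hD x y : h (x + y) = h x + h y by apply: val_inj; rewrite /= gD -(val_hfieldD (h x) (h y)).
have hM x y : h (x * y) = h x * h y by apply: val_inj; rewrite /= gM -(val_hfieldM (h x) (h y)).
have hB : zmod_morphism h.
  by move=> x y; apply/eqP; rewrite eq_sym subr_eq -hD subrK.
pose ha := GRing.isZmodMorphism.Build realalg Fp h hB.
pose hm := GRing.isMonoidMorphism.Build realalg Fp h (conj h1 hM).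
pose g' : {rmorphism realalg -> Fp} := HB.pack h ha hm.
exact: inhabits g'.
Qed.

Lemma root_const (Q : {poly int}) (x : Fp) :
  F [set i | root (map_poly intr Q) (res x i)] -> root (map_poly intr Q) x.
Proof.
move=> FQ; apply/eqP/hfield_eq.
have hE (K : fieldType) (y : K) : (map_poly intr Q).[y] = \sum_(k < size Q) (Q`_k)%:~R * y ^+ k.
  rewrite (horner_coef_wide _ (n := size Q)) ?size_poly //.
  by apply: eq_bigr => k _; rewrite coef_map.
have term k : F [set i | res ((Q`_k)%:~R * x ^+ k) i = (Q`_k)%:~R * res x i ^+ k].
  apply: filterS3 (resM (Q`_k)%:~R (x ^+ k)) (res_int pp Q`_k) (resX x k).
  by move=> i /= -> -> ->.
have terms : F [set i | forall k : 'I_(size Q), k \in enum 'I_(size Q) ->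
    res ((Q`_k)%:~R * x ^+ k) i = (Q`_k)%:~R * res x i ^+ k].
  by apply: (@filter_all_seq _ _ F _ (enum 'I_(size Q)) (fun (k : 'I_(size Q)) i =>
    res ((Q`_k)%:~R * x ^+ k) i = (Q`_k)%:~R * res x i ^+ k)) => k _; apply: term.
apply: filterS3 (filterI FQ (res0 pp)) (res_sum (index_enum 'I_(size Q))
  (fun k : 'I_(size Q) => (Q`_k)%:~R * x ^+ k)) terms.
move=> i /= [/rootP E1 ->] E3 E4; rewrite hE E3 -[RHS]E1 hE; apply: eq_bigr => k _.
by rewrite E4 ?mem_enum.
Qed.

(** With standard bounds there are finitely many candidate polynomials, so one of them works almost
    everywhere. *)
Lemma bounded_int_poly_fin (N B : nat) (P : I -> {poly int} -> Prop) :
    F [set i | exists Q : {poly int}, [/\ (size Q <= N)%N,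
      forall k, (`|(Q`_k)%R| <= B)%N & P i Q]] ->
  exists Q, F [set i | P i Q].
Proof.
move=> FP.
(* Coefficients in [-B, B] are shifted by B to index a finite type. *)
pose dec (f : {ffun 'I_N -> 'I_(B + B).+1}) : {poly int} :=
  \poly_(k < N) (if insub k is Some j then (f j : nat)%:Z - B%:Z else 0).
have [|f fP] := @ultra_fin _ F FU {ffun 'I_N -> 'I_(B + B).+1} (fun i f => P i (dec f)).
  apply: filterS FP => i [Q [QN QB PQ]].
  exists [ffun k : 'I_N => inord `|(Q`_k + B%:Z)%R|]; suff -> : dec [ffun k : 'I_N => inord `|(Q`_k + B%:Z)%R|] = Q by [].
  apply/polyP => k; rewrite coef_poly; case: ltnP => kN; last first.
    by rewrite nth_default // (leq_trans QN).
  rewrite insubT ffunE /= inordK; move: (QB k); move: (Q`_k : int) => z zB; last by lia.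
  rewrite gez0_abs; first by rewrite addrK.
  lia.
by exists (dec f).
Qed.

(** One integer polynomial Q vanishes at x in almost all coordinates, hence in the ultraproduct, and
    [rcf_root_image] places x in the image of g. *)
Lemma standard_height_image (g : {rmorphism realalg -> Fp}) N (x : Fp) :
  F [set i | height_le N N (res x i)] -> exists r, g r = x.
Proof.
move=> FN.
have [|Q QP] := @bounded_int_poly_fin N.+1 (2 ^ (N * (N + N.+1) + N * N))
  (fun i Q => map_poly intr Q != 0 :> {poly 'F_(repr p i)} /\ root (map_poly intr Q) (res x i)).
  by apply: filterS FN => i /height_le_intpoly[Q [sQ bQ Q0 Qx]]; exists Q.
have Q0 : Q != 0.
  by have [i [/= + _]] := filter_ex QP; apply: contra => /eqP->; rewrite rmorph0.
have Qx : root (map_poly intr Q) x.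
  by apply: root_const; apply: filterS QP => i [].
have inj : injective (intr : int -> realalg) by exact: intr_inj.
apply: (rcf_root_image hfield_nosq (P := map_poly intr Q)).
  by rewrite map_poly_eq0_id0 // intr_eq0 lead_coef_eq0.
by rewrite -map_poly_comp (eq_map_poly (g := intr)) // => z /=; rewrite rmorph_int.
Qed.

Lemma fQbar_standard_image (g : {rmorphism realalg -> Fp}) N (x : Fp) :
  (fQbar p (sval x) < hconst FU N)%O -> exists r, g r = x.
Proof.
move=> /hyper_lt xN; apply: (@standard_height_image g N).
apply: filterS3 (fQbar_height pp (sval x)) xN (repr_hconst FU N) => i /= xi + E.
rewrite E => lN; exact: height_le_leq (ltnW lN) (ltnW lN) xi.
Qed.

Lemma phi_standard d N : degree_index d -> phi p d (hconst FU N).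
Proof.
have [g] := realalg_morphism.
move=> dI; apply/(phi_hfield pp); case: eqP dI => [_ _|d2 [//|[oddd d1]]].
  move=> _ _ /fQbar_standard_image-/(_ g)[r <-] /fQbar_standard_image-/(_ g)[s <-].
  exists (g (Num.sqrt (r ^+ 2 + s ^+ 2))).
  by rewrite -!rmorphXn /= sqr_sqrtr ?rmorphD // addr_ge0 ?sqr_ge0.
move=> a aN; have /choice[r rE] : forall i, exists r, g r = a i.
  by move=> i; apply: fQbar_standard_image (aN i).
pose P : {poly realalg} := 'X^d + \poly_(i < d) (if insub i is Some j then r j else 0).
have szP : size P = d.+1.
  by rewrite size_polyDl size_polyXn // ltnS size_poly.
have [|y /rootP Py] := @odd_poly_root _ P; first by rewrite szP /= oddd.
exists (g y); move: Py => /(congr1 g); rewrite rmorph0 => gP; rewrite -[RHS]gP.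
rewrite /P hornerD hornerXn horner_poly rmorphD rmorphXn rmorph_sum /=.
congr (_ + _); apply: eq_bigr => i _; rewrite rmorphM rmorphXn /= -rE.
by rewrite insubT //= => H; congr (g (r _) * _); apply: val_inj.
Qed.

(** Without it [n_] could be the default value of [hmax]. The internal set is inhabited by
    [phi_standard] and bounded by p through [phi_at_lt]. *)
Lemma n_greatest d : degree_index d -> is_greatest (phi p d) (n_ p d).
Proof.
move=> dI; have [||x xP] := @internal_greatest _ F FU _ (fun i => phi_at d (repr p i)) (phi_transfer pp d).
- have := (phi_transfer pp d _).1 (phi_standard 0 dI).
  by apply: filterS => i; exists (repr (hconst FU 0) i).
- apply: filterS3 pp (nonstandard_gt 4) residue_nosq => i pi p4 nosq.
  by exists (repr p i) => n /(phi_at_lt pi p4 nosq dI)/ltnW.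
by rewrite /n_ (hmax_greatest xP).
Qed.

Lemma n_gt_standard d N : degree_index d -> (hconst FU N < n_ p d)%O.
Proof.
move=> dI; have [_ /(_ _ (phi_standard N.+1 dI))] := n_greatest dI.
move=> /hyper_le H; apply/hyper_lt.
by apply: filterS3 H (repr_hconst FU N) (repr_hconst FU N.+1) => i /= + -> E2; rewrite E2.
Qed.

End StandardPart.

(** * The real closed field attached to a cut *)

Section CutField.
Local Open Scope classical_set_scope.
Local Open Scope quotient_scope.
Local Open Scope ring_scope.
Context (I : Type) (F : set_system I) (FU : UltraFilter F).
Local Notation HN := (hypernat FU).
Local Notation cls u := (\pi_HN u).

Section Cut.
Variable C : set HN.
Hypothesis cutC : cut C.
Hypothesis semiC : sub_semiring C.

Lemma semi_add (u v : I -> nat) : C (cls u) -> C (cls v) -> C (cls (fun i => u i + v i)%N).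
Proof.
have [_ _ CD _] := semiC; move=> Cu Cv.
by have := CD _ _ Cu Cv; rewrite [cls u + cls v](hlift2_pi FU addn).
Qed.

Lemma semi_mul (u v : I -> nat) : C (cls u) -> C (cls v) -> C (cls (fun i => u i * v i)%N).
Proof.
have [_ _ _ CM] := semiC; move=> Cu Cv.
by have := CM _ _ Cu Cv; rewrite [cls u * cls v](hlift2_pi FU muln).
Qed.

Lemma semi_const n : C (cls (fun=> n)).
Proof.
have [C0 C1 _ _] := semiC; elim: n => [|n Cn]; first exact: C0.
exact: (semi_add (u := fun=> 1%N) C1 Cn).
Qed.

Lemma semi_exp (u : I -> nat) n : C (cls u) -> C (cls (fun i => u i ^ n)%N).
Proof.
move=> Cu; elim: n => [|n IHn]; first exact: (semi_const 1).
rewrite (_ : (fun i => _) = (fun i => u i * u i ^ n)%N); first exact: semi_mul.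
by apply/funext => i; rewrite expnS.
Qed.

Lemma semi_sum (d : nat) (u : 'I_d -> I -> nat) : (forall j, C (cls (u j))) ->
  C (cls (fun i => \sum_j u j i)%N).
Proof.
move=> Cu; elim: d u Cu => [|d IHd] u Cu.
  rewrite (_ : (fun i => _) = fun=> 0%N); first exact: semi_const.
  by apply/funext => i; rewrite big_ord0.
rewrite (_ : (fun i => _) = (fun i => \sum_(j < d) u (widen_ord (leqnSn d) j) i + u ord_max i)%N).
  by apply: semi_add => //; apply: IHd.
by apply/funext => i; rewrite big_ord_recr.
Qed.

(** An unbounded countable D would exhibit C as the union of the internal segments below the
    elements of D. *)
Lemma countable_bounded : ~ sigma_set C -> forall D : set HN, D `<=` C -> countable D ->
  exists2 c, C c & forall x, D x -> (x < c)%O.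
Proof.
move=> nsig D DC /countable_injP[g gI]; apply: contrapT => nb; apply: nsig.
exists (fun k => [set x | exists y, [/\ D y, g y = k & (x <= y)%O]]); split.
  move=> k; have [[y [Dy gy]]|ny] := pselect (exists y, D y /\ g y = k).
    exists (fun i => [set n | (n <= repr y i)%N]).
    rewrite eqEsubset; split=> x /=.
      move=> [z [Dz gz xz]]; have -> : y = z by apply: gI; rewrite ?inE // gz.
      exact/hyper_le.
    by move=> /hyper_le xy; exists y.
  exists (fun=> set0); rewrite eqEsubset; split=> x /=.
    by move=> [y [Dy gy _]]; case: ny; exists y.
  by move=> F0; have [i []] := filter_ex F0.
rewrite eqEsubset; split=> x.
  move=> Cx; apply: contrapT => nx; apply: nb; exists x => // y Dy.
  by rewrite ltNge; apply/negP => xy; apply: nx; exists (g y) => //; exists y.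
by move=> [k _ [y [Dy _ xy]]]; apply: cutC xy _; apply: DC.
Qed.

End Cut.

Variables (p : HN) (pp : hprime p).
Hypothesis p_nonstd : nonstandard p.
Hypothesis p_realalg : contains_real_algebraic_numbers p.
Hypothesis p_nosqrt : no_sqrt_of_minus_one p.
Local Notation Fp := (hfield pp).
Local Notation res x := (residue p (sval (x : Fp))).

Variable C : set HN.
Hypothesis cutC : cut C.
Hypothesis semiC : sub_semiring C.

Definition cut_mem (x : Fp) : bool := `[< C (fQbar p (sval x)) >].

(** Any height bound in C can replace the exact minimum, so field operations need only bounds built
    from elements of C. *)
Lemma cut_memP (x : Fp) : reflect
  (exists2 u : I -> nat, C (cls u) & F [set i | height_le (u i) (u i) (res x i)])
  (cut_mem x).
Proof.
apply: (iffP (asboolP _)) => [Cx|[u Cu xu]].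
  by exists (repr (fQbar p (sval x))); [rewrite reprK|exact: fQbar_height].
by apply: (cutC (fQbar_le pp xu)); apply: semi_add.
Qed.

Lemma cut_mem1 : cut_mem 1.
Proof.
apply/cut_memP; exists (fun=> 1%N); first exact: semi_const.
by apply: filterS (res1 pp) => i /= ->; apply: height_le_leq (height_le1 _).
Qed.

Lemma cut_memB x y : cut_mem x -> cut_mem y -> cut_mem (x - y).
Proof.
move=> /cut_memP[u Cu xu] /cut_memP[v Cv yv].
(* Dimension bound plus exponent bound of [height_leD], so that one number dominates both; the next
   witnesses are formed alike. *)
apply/cut_memP; exists (fun i => u i * v i + (u i + v i + 1))%N.
  by do ?[apply: semi_add|apply: semi_mul|apply: semi_const].
apply: filterS3 (filterI xu yv) (resD x (- y)) (resN y) => i /= [xi yi] -> ->.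
by apply: height_le_leq (height_leD xi (height_leN yi)); lia.
Qed.

Lemma cut_memM x y : cut_mem x -> cut_mem y -> cut_mem (x * y).
Proof.
move=> /cut_memP[u Cu xu] /cut_memP[v Cv yv].
apply/cut_memP; exists (fun i => u i * v i + (u i + v i + (u i + v i) * 2))%N.
  by do ?[apply: semi_add|apply: semi_mul|apply: semi_const].
apply: filterS3 xu yv (resM x y) => i /= xi yi ->.
by apply: height_le_leq (height_leM xi yi); lia.
Qed.

Lemma cut_memV x : cut_mem x -> cut_mem x^-1.
Proof.
move=> /cut_memP[u Cu xu].
apply/cut_memP; exists (fun i => u i + (u i * (u i + (u i + 1)) + u i * u i))%N.
  by do ?[apply: semi_add|apply: semi_mul|apply: semi_const].
apply: filterS2 xu (resV x) => i /= xi ->.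
by apply: height_le_leq (height_leV xi); rewrite ?leq_addr // addn1 leq_addl.
Qed.

Lemma cut_mem_root d (a : 'I_d -> Fp) x : (0 < d)%N -> (forall j, cut_mem (a j)) ->
  x ^+ d + \sum_j a j * x ^+ j = 0 -> cut_mem x.
Proof.
move=> d0 /(_ _)/cut_memP aC xa.
have {aC}/choice[u uC] : forall j, exists u : I -> nat,
    C (cls u) /\ F [set i | height_le (u i) (u i) (res (a j) i)].
  by move=> j; have [u Cu au] := aC j; exists u.
(* The sum bounds all coefficients at once and stays in C because d is standard. *)
pose w i := (\sum_j u j i)%N.
have Cw : C (cls w) by apply: semi_sum => // j; have [] := uC j.
apply/cut_memP; exists (fun i => d * w i ^ d + w i * d)%N.
  by do ?[apply: semi_add|apply: semi_mul|apply: semi_const|apply: semi_exp].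
have aw : F [set i | forall j, j \in enum 'I_d -> height_le (w i) (w i) (res (a j) i)].
  apply: (@filter_all_seq _ _ F _ (enum 'I_d)
    (fun j i => height_le (w i) (w i) (res (a j) i))) => j _.
  have [_ ] := uC j; apply: filterS => i; apply: height_le_leq; rewrite /w (bigD1 j) //= leq_addr //.
apply: filterS3 aw (res_monic_poly a x) (res0 pp) => i aw'; rewrite /mkset xa => E1 E0.
have : height_le (d * w i ^ d) (w i * d) (res x i).
  apply: (height_le_root (a := fun j => res (a j) i) d0); last by rewrite -E1.
  by move=> j; apply: aw'; rewrite mem_enum.
by apply: height_le_leq; rewrite ?leq_addr ?leq_addl.
Qed.

Hypothesis CCp : C `<=` C_ p.

Lemma cut_lt_n d x : degree_index d -> C x -> (x < n_ p d)%O.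
Proof.
move=> dI /CCp/(_ (d, 1%N))/=-/(_ (conj dI (leqnn _))).
rewrite /initial_segment /= /hceil_root (_ : hmin _ = n_ p d) //.
by apply: hmin_least; split=> [|y]; rewrite /= ?expr1.
Qed.

Lemma cut_divring : divring_closed (cut_mem : {pred Fp}).
Proof.
split; [exact: cut_mem1|exact: cut_memB|].
by move=> x y Cx Cy; exact: (cut_memM Cx (cut_memV Cy)).
Qed.

Lemma cut_rcf : exists (R : rcfType) (h : {rmorphism R -> Fp}),
  (forall x, cut_mem x <-> exists r, h r = x) /\
  (forall x y, x <= y <-> exists z, z ^+ 2 = h y - h x).
Proof.
have n_P d dI := n_greatest pp p_nonstd p_realalg p_nosqrt (d := d) dI.
pose S : divringClosed Fp := HB.pack cut_mem (GRing.isDivringClosed.Build Fp cut_mem cut_divring).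
have S0 : cut_mem 0 by rewrite -(subrr 1); apply: cut_memB cut_mem1 cut_mem1.
have SN x : cut_mem x -> cut_mem (- x) by rewrite -sub0r; apply: cut_memB S0.
(* z is a root of the monic polynomial X^2 + 0 X - z^2, whose coefficients lie in S. *)
have sqrtS (z : Fp) : z ^+ 2 \in S -> z \in S.
  move=> zS; apply: (@cut_mem_root 2 (fun j => if j == 0%N :> nat then - z ^+ 2 else 0)).
  - by [].
  - by move=> j; case: ifP => _; [exact: SN|exact: S0].
  by rewrite !big_ord_recr big_ord0 /= add0r mul0r addr0 expr0 mulr1 subrr.
have sqD (x y : Fp) : x \in S -> y \in S -> exists z, x ^+ 2 + y ^+ 2 = z ^+ 2.
  move=> /asboolP xS /asboolP yS; have d2 : degree_index 2 by left.
  have [/(phi_hfield pp) H _] := n_P _ d2.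
  exact: H (cut_lt_n d2 xS) (cut_lt_n d2 yS).
have oddS (P : {poly Fp}) : P \is a polyOver S -> P \is monic -> ~~ odd (size P) ->
    exists2 x, x \in S & root P x.
  move=> /polyOverP PS Pm Podd.
  have P0 : P != 0 by apply: monic_neq0.
  have [d szP] : exists d, size P = d.+1 by exists (size P).-1; rewrite prednK // size_poly_gt0.
  have rootE' x : root P x = (x ^+ d + \sum_(j < d) P`_j * x ^+ j == 0).
    rewrite rootE horner_coef szP big_ord_recr /=.
    by move/monicP: Pm; rewrite lead_coefE szP => ->; rewrite mul1r addrC.
  move: Podd; rewrite szP /= negbK => oddd.
  have d0 : (0 < d)%N by case: (d) oddd.
  suff [x xE] : exists x, x ^+ d + \sum_(j < d) P`_j * x ^+ j = 0.
    exists x; last by rewrite rootE' xE eqxx.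
    exact: (cut_mem_root d0 (fun j : 'I_d => PS j) xE).
  (* Degree 1 is solved directly, since thresholds are indexed by odd d > 1. *)
  have [d1|d1] := leqP d 1.
    have d1' : d = 1%N by apply/eqP; rewrite eqn_leq d1.
    by rewrite d1'; exists (- P`_0); rewrite big_ord_recr big_ord0 /= add0r expr0 mulr1 expr1 addNr.
  have dI : degree_index d := or_intror (conj oddd d1).
  have [/(phi_hfield pp)] := n_P _ dI; rewrite gtn_eqF; last by case: (d) d1 oddd => [|[|[|]]].
  move=> H _; apply: (H (fun j : 'I_d => P`_j)) => j.
  exact: (cut_lt_n dI (asboolW (PS j))).
have [R [h [hS hle]]] := rcf_of_subfield (S := S) (hfield_nosq p_nosqrt) (hfield_square p_nosqrt) sqrtS sqD oddS.
exists R, h; split; [exact: hS|exact: hle].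
Qed.

End CutField.

(** * Filling countable gaps in the field of a cut *)

Section CutSaturation.
Local Open Scope classical_set_scope.
Local Open Scope quotient_scope.
Local Open Scope ring_scope.

Lemma finite_set_max (d : Order.disp_t) (T : orderType d) (S : set T) : finite_set S ->
  S = set0 \/ exists2 m, S m & forall x, S x -> (x <= m)%O.
Proof.
move=> /finite_seqP[s ->]; elim: s => [|x s [s0|[m ms mmax]]]; first by left; rewrite set_nil.
  right; exists x; first by rewrite /= mem_head.
  move=> y; rewrite /= inE => /predU1P[->//|ys].
  by have : [set` s] y by []; rewrite s0.
right; have [xm|mx] := leP x m.
  exists m; first by rewrite /= inE ms orbT.
  by move=> y; rewrite /= inE => /predU1P[->//|]; apply: mmax.
exists x; first by rewrite /= mem_head.
by move=> y; rewrite /= inE => /predU1P[->//|/mmax ym]; apply: le_trans ym (ltW mx).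
Qed.

Lemma finite_set_min (d : Order.disp_t) (T : orderType d) (S : set T) : finite_set S ->
  S = set0 \/ exists2 m, S m & forall x, S x -> (m <= x)%O.
Proof. exact: (@finite_set_max _ T^d). Qed.

Lemma countable_setU (T : Type) (A B : set T) :
  countable A -> countable B -> countable (A `|` B).
Proof.
move=> cA cB; rewrite (_ : A `|` B = \bigcup_(b in [set: bool]) if b then A else B).
  by apply: bigcup_countable => [|[]].
rewrite eqEsubset; split=> x; first by case; [exists true|exists false].
by move=> [[] _]; [left|right].
Qed.

(** A finite piece of the gap is filled by a midpoint, or by b - 1, a + 1 or 0 when one or both
    sides are empty. Countability of M allows a single height bound for all these fillers. *)
Lemma countable_interpolant (R : realFieldType) (A B : set R) :
    countable A -> countable B -> (forall a b, A a -> B b -> a < b) ->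
  exists2 M : set R, countable M & forall A' B' : set R, finite_set A' -> finite_set B' ->
    A' `<=` A -> B' `<=` B ->
    exists2 m, M m & (forall a, A' a -> a < m) /\ (forall b, B' b -> m < b).
Proof.
move=> cA cB AB.
exists ([set 0] `|` (fun a => a + 1) @` A `|` (fun b => b - 1) @` B `|`
    (fun ab => (ab.1 + ab.2) / 2) @` (A `*` B)).
  have im (T : Type) (f : T -> R) (S : set T) : countable S -> countable (f @` S).
    by apply: sub_countable; apply: card_image_le.
  do !apply: countable_setU; [exact: countable1|exact: im|exact: im|].
  exact/im/countableX.
move=> A' B' fA fB sA sB.
have [A0|[a A'a amax]] := finite_set_max fA; have [B0|[b B'b bmin]] := finite_set_min fB.
- by exists 0; [do 3 left|rewrite A0 B0].
- exists (b - 1); first by left; right; exists b => //; apply: sB.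
  by rewrite A0; split=> // b' /bmin; lra.
- exists (a + 1); first by do 2 left; right; exists a => //; apply: sA.
  by rewrite B0; split=> // a' /amax; lra.
- have ab : a < b by apply: AB; [apply: sA|apply: sB].
  exists ((a + b) / 2); first by right; exists (a, b) => //; split; [apply: sA|apply: sB].
  by split=> [a' /amax|b' /bmin]; lra.
Qed.

Context (I : Type) (F : set_system I) (FU : UltraFilter F).
Local Notation HN := (hypernat FU).
Local Notation cls u := (\pi_HN u).
Hypothesis Finc : countably_incomplete F.
Variables (p : HN) (pp : hprime p).
Local Notation Fp := (hfield pp).
Local Notation res x := (residue p (sval (x : Fp))).

(** The strict order: z nonzero passes to coordinates in both directions. *)
Definition nonzero_square (K : fieldType) (y : K) : Prop := exists2 z, z != 0 & z ^+ 2 = y.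

Lemma nonzero_square_residue (x y : Fp) : nonzero_square (y - x) <->
  F [set i | nonzero_square (res y i - res x i)].
Proof.
have yxE : F [set i | res (y - x) i = res y i - res x i].
  by apply: filterS2 (resD y (- x)) (resN x) => i /= -> ->.
split=> [[z z0 zE]|Fz].
  have nz0 : ~ F [set i | res z i = 0].
    by move=> zi; case/eqP: z0; apply: hfield_eq; apply: filterS2 zi (res0 pp) => i /= -> ->.
  have zE' := (res_eq _ _).1 zE.
  apply: filterS3 ((ultraN FU _).1 nz0) yxE (filterI zE' (resX z 2)) => i /= /eqP nz <- [<- zX].
  by exists (res z i).
have [z zE] := @ultra_dchoice _ F FU (fun i => 'F_(repr p i)) (fun i => 0)
  (fun i z => z != 0 /\ z ^+ 2 = res y i - res x i) (filterS (fun i '(ex_intro2 z z0 zE) => ex_intro _ z (conj z0 zE)) Fz).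
exists (of_res pp z).
  apply/eqP => z0.
  have [i [[/negP nz _] [E1 [E2 E3]]]] := filter_ex (filterI zE (filterI (res_of_res pp z)
     (filterI (res0 pp) ((res_eq _ _).1 z0)))).
  by apply: nz; rewrite -E1 E3 E2.
apply: hfield_eq.
by apply: filterS3 (filterI (resX (of_res pp z) 2) (res_of_res pp z)) zE yxE => i /= [-> ->] [_ ->] ->.
Qed.

Variable C : set HN.
Hypothesis cutC : cut C.
Hypothesis semiC : sub_semiring C.
Hypothesis nsigC : ~ sigma_set C.
Variables (R : rcfType) (h : {rmorphism R -> Fp}).
Hypothesis hC : forall x, cut_mem C x <-> exists r, h r = x.
Hypothesis hle : forall x y, x <= y <-> exists z, z ^+ 2 = h y - h x.

Lemma cut_lt x y : x < y <-> nonzero_square (h y - h x).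
Proof.
split=> [xy|[z z0 zE]].
  have [z zE] := (hle x y).1 (ltW xy); exists z => //.
  apply: contraTneq xy => z0; move/eqP: zE; rewrite z0 expr0n eq_sym subr_eq0 => /eqP/fmorph_inj->.
  by rewrite ltxx.
rewrite lt_neqAle; apply/andP; split; last by apply/hle; exists z.
by apply: contraNneq z0 => xy; move/eqP: zE; rewrite xy subrr sqrf_eq0.
Qed.

Lemma cut_eta1 : eta1 R.
Proof.
move=> A B cA cB AB.
have [M cM MP] := countable_interpolant cA cB AB.
(* Saturation alone yields a point of the hyperfinite field; the internal condition of height below
   c keeps it in the field of the cut. *)
have [c Cc Mc] : exists2 c, C c & forall m, M m -> (fQbar p (sval (h m)) < c)%O.
  have [||c Cc Dc] := countable_bounded cutC nsigC (D := (fun m => fQbar p (sval (h m))) @` M).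
  - move=> _ [m _ <-]; have /asboolP : cut_mem C (h m) by apply/hC; exists m.
    exact: id.
  - by apply: sub_countable cM; apply: card_image_le.
  by exists c => // m Mm; apply: Dc; exists m.
have cAB := countable_setU cA cB.
have [g gI] := countable_injP _ cAB.
(* Condition k involves at most one element of A or B, since [g] is injective on their union; the
   height condition is repeated in each. *)
pose P k i (t : nat) := [/\ cheap (repr p i) (repr c i) (t%:R : 'F_(repr p i)),
  (forall a, A a -> g a = k -> nonzero_square ((t%:R : 'F_(repr p i)) - res (h a) i)) &
  (forall b, B b -> g b = k -> nonzero_square (res (h b) i - (t%:R : 'F_(repr p i))))].
have finAB S n : S `<=` A `|` B -> finite_set [set a | S a /\ (g a <= n)%N].
  move=> SAB.
  have gI' : {in [set a | S a /\ (g a <= n)%N] &, injective g}.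
    by move=> x y /set_mem[Sx _] /set_mem[Sy _]; apply: gI; apply/mem_set/SAB.
  rewrite -(eq_finite_set (inj_card_eq gI')).
  by apply: sub_finite_set (finite_II n.+1) => _ [a [_ an] <-].
have [|u uP] := internal_saturation FU Finc 0%N (B := P).
  move=> n.
  have [||||m Mm [Am Bm]] := MP [set a | A a /\ (g a <= n)%N] [set b | B b /\ (g b <= n)%N].
  - by apply: finAB => x; left.
  - by apply: finAB => x; right.
  - by move=> x [].
  - by move=> x [].
  suff : F [set i | forall k, k \in iota 0 n.+1 -> P k i (repr (sval (h m)) i)].
    by apply: filterS => i Pi; exists (repr (sval (h m)) i) => k kn; apply: Pi; rewrite mem_iota ltnS.
  apply: (@filter_all_seq _ _ F _ _ (fun k i => P k i (repr (sval (h m)) i))) => k.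
  rewrite mem_iota ltnS => /= kn.
  have cm := (fQbar_hfield_lt (h m) c).1 (Mc m Mm).
  have Fa : F [set i | forall a, A a -> g a = k -> nonzero_square (res (h m) i - res (h a) i)].
    have [[a [Aa ga]]|na] := pselect (exists a, A a /\ g a = k); last first.
      by apply: filterE => i a Aa ga; case: na; exists a.
    have am : a < m by apply: Am; split=> //; rewrite ga.
    apply: filterS ((nonzero_square_residue _ _).1 ((cut_lt _ _).1 am)) => i ai a' Aa' ga'.
    by have -> : a' = a by apply: gI; rewrite ?ga' ?ga //; apply/mem_set; left.
  have Fb : F [set i | forall b, B b -> g b = k -> nonzero_square (res (h b) i - res (h m) i)].
    have [[b [Bb gb]]|nb] := pselect (exists b, B b /\ g b = k); last first.
      by apply: filterE => i b Bb gb; case: nb; exists b.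
    have mb : m < b by apply: Bm; split=> //; rewrite gb.
    apply: filterS ((nonzero_square_residue _ _).1 ((cut_lt _ _).1 mb)) => i bi b' Bb' gb'.
    by have -> : b' = b by apply: gI; rewrite ?gb' ?gb //; apply/mem_set; right.
  by apply: filterS3 cm Fa Fb => i cmi Fai Fbi; split.
pose x := of_res pp (fun i => (u i)%:R).
have xE : F [set i | res x i = (u i)%:R] := res_of_res pp _.
have [r rx] : exists r, h r = x.
  apply/hC/asboolP; apply: (cutC _ Cc); apply/ltW/fQbar_hfield_lt.
  by apply: filterS2 xE (uP 0%N) => i /= -> [].
exists r; split=> [a Aa|b Bb]; apply/cut_lt; rewrite rx; apply/nonzero_square_residue.
  by apply: filterS2 xE (uP (g a)) => i /= -> [_ H _]; apply: H.
by apply: filterS2 xE (uP (g b)) => i /= -> [_ _ H]; apply: H.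
Qed.

End CutSaturation.

(** * C_p is a semiring cut and not a sigma-set *)

Section LargestCut.
Local Open Scope classical_set_scope.
Local Open Scope quotient_scope.
Local Open Scope ring_scope.
Context (I : Type) (F : set_system I) (FU : UltraFilter F).
Local Notation HN := (hypernat FU).
Local Notation cls u := (\pi_HN u).
Hypothesis Finc : countably_incomplete F.
Variables (p : HN).
Hypothesis n_standard : forall d N, degree_index d -> (hconst FU N < n_ p d)%O.

Lemma hyper_exp_le (x y : HN) j : (x <= y)%O -> (x ^+ j <= y ^+ j)%O.
Proof.
move=> /hyper_le xy; apply/hyper_le.
apply: filterS3 (repr_hexp x j) (repr_hexp y j) xy => i /= -> -> xyi.
by case: (j) => // k; rewrite leq_exp2r.
Qed.

(** The ceiling is a least element with n <= r ^ j, so lying strictly below it means failing that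
    inequality; roots disappear from then on. *)
Lemma lt_hceil_root j (n x : HN) : (0 < j)%N -> (x < hceil_root j n)%O = (x ^+ j < n)%O.
Proof.
move=> j0.
have SP (r : HN) : (n <= r ^+ j)%O <-> F [set i | (repr n i <= repr r i ^ j)%N].
  by rewrite hyper_le; split=> H; apply: filterS2 (repr_hexp r j) H => i /= ->.
have [|u [uS umin] _] := @internal_least _ F FU [set r | (n <= r ^+ j)%O] (fun i r => (repr n i <= r ^ j)%N) SP.
  apply: filterE => i; exists (repr n i); case: j j0 {SP} => // j _.
  by case: (repr n i) => // k; rewrite -[X in (X <= _)%N]expn1 leq_pexp2l.
have -> : hceil_root j n = cls u by apply: hmin_least.
apply/idP/idP; rewrite !ltNge; first by apply: contra => /umin.
by apply: contra => ux; apply: le_trans (uS) (hyper_exp_le j ux).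
Qed.

Lemma C_P (x : HN) : C_ p x <-> forall d j, degree_index d -> (0 < j)%N -> (x ^+ j < n_ p d)%O.
Proof.
split=> [Cx d j dI j0|H [d j] [/= dI j0]].
  by have := Cx (d, j) (conj dI j0); rewrite /initial_segment /= lt_hceil_root.
by rewrite /initial_segment /= lt_hceil_root //; apply: H.
Qed.

Lemma C_cut : cut (C_ p).
Proof.
move=> x y xy /C_P Cy; apply/C_P => d j dI j0.
exact: le_lt_trans (hyper_exp_le j xy) (Cy d j dI j0).
Qed.

Lemma C_standard N : C_ p (hconst FU N).
Proof.
apply/C_P => d j dI j0; apply: le_lt_trans (n_standard (N ^ j) dI).
apply/hyper_le; apply: filterS3 (repr_hexp (hconst FU N) j) (repr_hconst FU N) (repr_hconst FU (N ^ j)).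
by move=> i /= -> -> ->.
Qed.

Lemma C_mul x y : C_ p x -> C_ p y -> C_ p (x * y).
Proof.
wlog xy : x y / (x <= y)%O => [wl Cx Cy|_ Cy].
  by have [/wl|/ltW/wl H] := leP x y; [apply|rewrite mulrC; apply: H].
apply: (C_cut (y := y ^+ 2)).
  rewrite expr2; apply/hyper_le.
  apply: filterS3 (repr_mul x y) (repr_mul y y) ((hyper_le _ _).1 xy) => i /= -> -> xyi.
  by rewrite leq_mul2r xyi orbT.
(* The intersection over all roots absorbs squaring: (y^2)^j is the power 2j of y. *)
by apply/C_P => d j dI j0; rewrite -exprM; apply: (C_P y).1 => //; rewrite muln_gt0.
Qed.

Lemma C_add x y : C_ p x -> C_ p y -> C_ p (x + y).
Proof.
wlog xy : x y / (x <= y)%O => [wl Cx Cy|_ Cy].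
  by have [/wl|/ltW/wl H] := leP x y; [apply|rewrite addrC; apply: H].
(* x + y <= 2y, and 2 lies in C_p because the thresholds are nonstandard. *)
apply: (C_cut (y := hconst FU 2 * y)); last by apply: C_mul => //; apply: C_standard.
apply/hyper_le; apply: filterS3 (repr_add x y) (filterI (repr_mul (hconst FU 2) y) (repr_hconst FU 2))
  ((hyper_le _ _).1 xy) => i /= -> [-> ->] xyi.
by rewrite mul2n -addnn leq_add2r.
Qed.

Lemma C_semiring : sub_semiring (C_ p).
Proof.
by split; [exact: (C_standard 0)|exact: (C_standard 1)|exact: C_add|exact: C_mul].
Qed.

(** The set is bounded by n_2, so if nonempty it has an internal maximum, which belongs to the set
    and hence to C_p. *)
Lemma internal_bounded (A : set HN) : internal A -> A `<=` C_ p ->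
  exists2 a, C_ p a & forall x, A x -> (x <= a)%O.
Proof.
move=> [A' ->] AC.
have [exA|nA] := pselect (F [set i | exists n, A' i n]); last first.
  exists (hconst FU 0); first exact: C_standard.
  by move=> x Ax; case: nA; apply: filterS Ax => i; exists (repr x i).
have d2 : degree_index 2 by left.
have [|||a [aA amax]] := @internal_greatest _ F FU [set x | F [set i | A' i (repr x i)]] A' => //.
  apply: contrapT => nb0; have nb := (ultraN FU _).1 nb0.
  have [|u uA] := @ultra_ex _ F FU nat 0%N (fun i n => A' i n /\ (repr (n_ p 2) i < n)%N).
    apply: filterS nb => i /= /forallNP/(_ (repr (n_ p 2) i))/existsNP[n /not_implyP[An nn]].
    by exists n; split=> //; rewrite ltnNge; apply/negP.
  have /AC/C_P/(_ 2%N 1%N d2 isT) : F [set i | A' i (repr (cls u) i)].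
    by apply: filterS2 uA (repr_ultra FU u) => i /= [? _] ->.
  rewrite expr1 ltNge => /negP; apply; apply/hyper_le.
  by apply: filterS2 uA (repr_ultra FU u) => i /= [_ /ltnW ?] ->.
by exists a => //; apply: AC.
Qed.

(** Countably many internal pieces have bounds a_k in C_p; saturation gives an element above all a_k
    satisfying all the countably many inequalities that define C_p. *)
Lemma C_not_sigma : ~ sigma_set (C_ p).
Proof.
move=> [A [Aint CA]].
have /choice[a aP] : forall k, exists b, C_ p b /\ forall x, A k x -> (x <= b)%O.
  move=> k; have [|b Cb bA] := internal_bounded (Aint k); last by exists b.
  by rewrite CA => x Ax; exists k.
pose B n i t := (repr (a n) i < t)%N /\
  forall d j, (d < n)%N -> (j < n)%N -> degree_index d -> (0 < j)%N -> (t ^ j < repr (n_ p d) i)%N.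
have [|u uP] := internal_saturation FU Finc 0%N (B := B).
  move=> n.
  (* For finitely many conditions, an element of C_p above the first bounds suffices: it meets every
     power inequality. *)
  have [s Cs sa] : exists2 s, C_ p s & forall k, (k <= n)%N -> (a k < s)%O.
    elim: n => [|n [s Cs sa]].
      exists (a 0%N + hconst FU 1).
        by apply: C_add; [exact: (aP 0%N).1|exact: C_standard].
      move=> k; rewrite leqn0 => /eqP->; apply/hyper_lt.
      apply: filterS2 (repr_add (a 0%N) (hconst FU 1)) (repr_hconst FU 1) => i /= -> ->.
      by rewrite addn1.
    exists (s + a n.+1 + hconst FU 1).
      by apply: C_add; [apply: C_add => //; exact: (aP n.+1).1|exact: C_standard].
    have sE : F [set i | repr (s + a n.+1 + hconst FU 1) i = (repr s i + repr (a n.+1) i).+1].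
      apply: filterS3 (repr_add (s + a n.+1) (hconst FU 1)) (repr_add s (a n.+1)) (repr_hconst FU 1).
      by move=> i /= -> -> ->; rewrite addn1.
    move=> k; rewrite leq_eqVlt => /predU1P[->|/sa kn]; apply/hyper_lt.
      by apply: filterS sE => i /= ->; rewrite ltnS leq_addl.
    apply: filterS2 sE ((hyper_lt _ _).1 kn) => i /= -> /ltnW ki.
    by rewrite ltnS (leq_trans ki) // leq_addr.
  have Fa : F [set i | forall k, k \in iota 0 n.+1 -> (repr (a k) i < repr s i)%N].
    apply: (@filter_all_seq _ _ F _ _ (fun k i => (repr (a k) i < repr s i)%N)) => k.
    by rewrite mem_iota ltnS => /sa/hyper_lt.
  have Fn : F [set i | forall dj, dj \in [seq (d, j) | d <- iota 0 n, j <- iota 0 n] ->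
      degree_index dj.1 -> (0 < dj.2)%N -> (repr s i ^ dj.2 < repr (n_ p dj.1) i)%N].
    apply: (@filter_all_seq _ _ F _ _ (fun dj i => degree_index dj.1 -> (0 < dj.2)%N ->
      (repr s i ^ dj.2 < repr (n_ p dj.1) i)%N)) => -[d j] _ /=.
    have [dI|ndI] := pselect (degree_index d); last by apply: filterE => i /ndI.
    have [j0|nj0] := posnP j; first by rewrite j0; apply: filterE.
    have /hyper_lt H := (C_P s).1 Cs d j dI nj0.
    by apply: filterS2 (repr_hexp s j) H => i /= -> H' _ _.
  apply: filterS2 Fa Fn => i ai ni; exists (repr s i) => k kn; split.
    by apply: ai; rewrite mem_iota ltnS.
  move=> d j dk jk dI j0; apply: (ni (d, j)) => //.
  by apply/allpairsP; exists (d, j); rewrite !mem_iota /= !add0n !(leq_trans _ kn).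
have uC : C_ p (cls u).
  apply/C_P => d j dI j0; apply/hyper_lt.
  apply: filterS3 (uP (maxn d j).+1) (repr_hexp (cls u) j) (repr_ultra FU u).
  by move=> i [_ H] /= -> ->; apply: H; rewrite ?ltnS ?leq_maxl ?leq_maxr.
have : C_ p (cls u) by [].
rewrite {1}CA => -[k _ /(aP k).2]; rewrite leNgt => /negP; apply.
apply/hyper_lt; apply: filterS2 (uP k) (repr_ultra FU u) => i [H _] /= ->.
exact: H.
Qed.

End LargestCut.

Local Open Scope classical_set_scope.

Theorem theorem4p9 (I : Type) (F : set_system I) (FU : UltraFilter F)
    (Finc : countably_incomplete F)
    (p : hypernat FU) (p_nonstd : nonstandard p) (p_prime : hprime p)
    (p_realalg : contains_real_algebraic_numbers p)
    (p_nosqrt : no_sqrt_of_minus_one p) :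
  (forall C : set (hypernat FU),
     C `<=` C_ p -> cut C -> sub_semiring C -> ~ sigma_set C ->
     aleph1_saturated_rcf p (fQbar_preimage p C))
  /\ aleph1_saturated_rcf p (fQbar_preimage p (C_ p)).
Proof.
have main (C : set (hypernat FU)) : C `<=` C_ p -> cut C -> sub_semiring C ->
    ~ sigma_set C -> aleph1_saturated_rcf p (fQbar_preimage p C).
  move=> CCp cutC semiC nsigC.
  have [R [h [hC hle]]] := cut_rcf p_prime p_nonstd p_realalg p_nosqrt cutC semiC CCp.
  exists R, (fun r => sval (h r)); split; last first.
    exact: eta1_saturated (cut_eta1 Finc cutC nsigC hC hle).
  split.
  - split; first by move=> r s rs; apply: (fmorph_inj h); apply: val_inj.
    rewrite eqEsubset; split=> x.
      move=> [r _ <-]; split; first exact: hfield_lt.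
      by apply/asboolP/(hC (h r)); exists r.
    move=> [xp Cx]; have [r rx] : exists r, h r = exist _ x xp.
      by apply/hC/asboolP.
    by exists r => //; rewrite rx.
  - by rewrite rmorph0 rmorph1 val_hfield0 val_hfield1.
  - by move=> r s; rewrite rmorphD val_hfieldD.
  - by move=> r s; rewrite rmorphM val_hfieldM.
  move=> r s; split=> [/hle[z zE]|[z zp zE]].
    exists (sval z); first exact: hfield_lt.
    by rewrite -val_hfieldM -expr2 zE val_hfieldB.
  apply/hle; exists (exist _ z zp); apply: val_inj.
  rewrite expr2; apply: etrans (val_hfieldM _ _) _; apply: etrans zE _.
  exact: esym (val_hfieldB _ _).
split=> //.
have n_std d N := n_gt_standard p_prime p_nonstd p_realalg p_nosqrt N (d := d).
apply: main.
- by [].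
- exact: C_cut.
- exact: (C_semiring n_std).
- exact: (C_not_sigma Finc n_std).
Qed.
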